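(* Let $R>0$. There is a constant $C>0$ depending only on $R$ (not on $k$ or $d$) such that for any $k$-atomic distributions $\Gamma,\Gamma'$ supported on the Euclidean ball $B(0,R)\subset\mathbb R^d$ and any $D\in\{H^2,\mathrm{KL},\chi^2\}$, $$(Ck)^{-4k}\max_{1\le\ell\le 2k-1}\|M_\ell(\Gamma)-M_\ell(\Gamma')\|_F^2\le D(P_\Gamma\,\|\,P_{\Gamma'})\le C e^{36k^2}\max_{1\le\ell\le2k-1}\|M_\ell(\Gamma)-M_\ell(\Gamma')\|_F^2.$$
   Context: $P_\Gamma=\Gamma*N(0,I_d)$. $M_\ell(\Gamma)=\mathbb E_{U\sim\Gamma}[U^{\otimes\ell}]\in(\mathbb R^d)^{\otimes\ell}$ is the order-$\ell$ moment tensor; for $\Gamma=\sum_j w_j\delta_{\mu_j}$, $M_\ell(\Gamma)=\sum_j w_j\mu_j^{\otimes\ell}$. $\|T\|_F=(\sum_{j_1,\dots,j_\ell}T_{j_1\dots j_\ell}^2)^{1/2}$. $H^2(P,Q)=\int(\sqrt p-\sqrt q)^2$, $\mathrm{KL}(P\|Q)=\int p\log(p/q)$, $\chi^2(P\|Q)=\int (p-q)^2/q$. *)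

(* Defs.v *)
From Stdlib Require Import Reals Lra List.
Import ListNotations.
Open Scope R_scope.

(* Vectors in R^d are functions nat -> R; only coordinates 0..d-1 matter. *)

Fixpoint sumn (n : nat) (f : nat -> R) : R :=
  match n with O => 0 | S m => sumn m f + f m end.

Definition sqnorm (d : nat) (x : nat -> R) : R := sumn d (fun j => x j * x j).

(* A k-atomic distribution on the ball B(0,Rr) in R^d:
   weights w 0..w (k-1) >= 0 summing to 1, atoms mu i : R^d with |mu i| <= Rr.
   (Zero weights allowed, so "at most k atoms".) *)
Definition katomic (k d : nat) (Rr : R) (w : nat -> R) (mu : nat -> nat -> R) : Prop :=
  (forall i, (i < k)%nat -> 0 <= w i) /\ sumn k w = 1 /\
  (forall i, (i < k)%nat -> sqrt (sqnorm d (mu i)) <= Rr).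

Fixpoint sumTuples (d l : nat) (F : list nat -> R) : R :=
  match l with
  | O => F nil
  | S l' => sumn d (fun j => sumTuples d l' (fun s => F (j :: s)))
  end.

Fixpoint prodCoords (x : nat -> R) (s : list nat) : R :=
  match s with nil => 1 | j :: s' => x j * prodCoords x s' end.

(* entry of the moment tensor M_l(Gamma) = sum_i w_i mu_i^{(x) l} at index s *)
Definition momEntry (k : nat) (w : nat -> R) (mu : nat -> nat -> R) (s : list nat) : R :=
  sumn k (fun i => w i * prodCoords (mu i) s).

Definition momDiffSq (k d l : nat) (w w' : nat -> R) (mu mu' : nat -> nat -> R) : R :=
  sumTuples d l (fun s => (momEntry k w mu s - momEntry k w' mu' s) ^ 2).

Fixpoint maxUpTo (L : nat) (g : nat -> R) : R :=
  match L with
  | O => g 1%nat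
  | S O => g 1%nat
  | S L' => Rmax (maxUpTo L' g) (g L)
  end.

(* Density of P_Gamma = Gamma * N(0, I_d) at x *)
Definition gauss (d : nat) (x m : nat -> R) : R :=
  / (sqrt (2 * PI)) ^ d * exp (- sqnorm d (fun j => x j - m j) / 2).

Definition mixDens (k d : nat) (w : nat -> R) (mu : nat -> nat -> R) (x : nat -> R) : R :=
  sumn k (fun i => w i * gauss d x (mu i)).

(* Integration over R^d: iterated Riemann integrals over cubes [-N,N]^d,
   then limit N -> infinity. *)
Definition upd (x : nat -> R) (j : nat) (t : R) : nat -> R :=
  fun i => if Nat.eqb i j then t else x i.

Fixpoint IntCube (N : R) (d : nat) (f : (nat -> R) -> R) (v : R) : Prop :=
  match d with
  | O => v = f (fun _ => 0)
  | S d' => exists g : R -> R,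
      (forall t, IntCube N d' (fun x => f (upd x d' t)) (g t)) /\
      exists pr : Riemann_integrable g (- N) N, RiemannInt pr = v
  end.

Definition IntRd (d : nat) (f : (nat -> R) -> R) (v : R) : Prop :=
  exists u : nat -> R, (forall N, IntCube (INR N) d f (u N)) /\ Un_cv u v.

Inductive Div := Hellinger2 | KLdiv | Chi2.

Definition divIntegrand (D : Div) (p q : R) : R :=
  match D with
  | Hellinger2 => (sqrt p - sqrt q) ^ 2
  | KLdiv => p * ln (p / q)
  | Chi2 => (p - q) ^ 2 / q
  end.

(* Main.v *)
Require Import Defs.
From Stdlib Require Import Reals Lra Lia List Factorial FunctionalExtensionality.
From Coquelicot Require Import Coquelicot.
Import ListNotations.
Open Scope R_scope.

(** Join the two mixtures into one signed measure nu on n = 2k atoms X_i, so that p - q is the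
    Gaussian mixture with weights nu, and let Q(c) = sum_{i,j} nu_i nu_j exp <X_i - c, X_j - c>,
    which is both the integral of (p - q)^2 / N(c, I) and the sum over l of |T_l(c)|_F^2 / l!,
    where T_l(c) = sum_i nu_i (X_i - c)^{(x) l}. Write m^2 for the maximum of |T_l(0)|_F^2 over
    1 <= l <= 2k - 1. Newton interpolation with tensor factors x - X_1, ..., x - X_n gives
    |T_l(c)|_F <= (1 + 3R)^l m for all l and |c| <= R, whatever k and d, so
    Q(c) <= exp((1 + 3R)^2) m^2, while Q(0) >= m^2 / (2k - 1)!.

    Pointwise, (sqrt p - sqrt q)^2 <= p ln(p/q) - p + q <= (p - q)^2 / q. Convexity of 1/t bounds
    the last term by the average of (p - q)^2 / N(mu'_j, I), whose integral is an average of
    Q(mu'_j); this is the upper bound. For the lower bound, the Hellinger integrand is tested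
    against g = (p - q) / N(0, I): the integral of (p - q) g is Q(0), and that of N(mu, I) g^2 is
    exp(-|mu|^2) Q(-mu). *)

(** * Finite sums, Cauchy-Schwarz and Minkowski *)

Lemma sumn_ext n f g : (forall i, (i < n)%nat -> f i = g i) -> sumn n f = sumn n g.
Proof.
  induction n as [|n IH]; intros H; simpl; [reflexivity|].
  rewrite IH by (intros; apply H; lia). rewrite H by lia. reflexivity.
Qed.

Lemma sumn_plus n f g : sumn n (fun i => f i + g i) = sumn n f + sumn n g.
Proof. induction n as [|n IH]; simpl; [lra|rewrite IH; lra]. Qed.

Lemma sumn_scal n c f : sumn n (fun i => c * f i) = c * sumn n f.
Proof. induction n as [|n IH]; simpl; [lra|rewrite IH; lra]. Qed.

Lemma sumn_le n f g : (forall i, (i < n)%nat -> f i <= g i) -> sumn n f <= sumn n g.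
Proof.
  induction n as [|n IH]; intros H; simpl; [lra|].
  apply Rplus_le_compat; [apply IH; intros; apply H; lia|apply H; lia].
Qed.

Lemma sumn_zero n f : (forall i, (i < n)%nat -> f i = 0) -> sumn n f = 0.
Proof.
  intros H. rewrite (sumn_ext n f (fun i => 0 * 0)) by (intros; rewrite H by assumption; ring).
  rewrite sumn_scal. ring.
Qed.

Lemma sumn_nonneg n f : (forall i, (i < n)%nat -> 0 <= f i) -> 0 <= sumn n f.
Proof.
  intros H. rewrite <- (sumn_zero n (fun _ => 0)) by reflexivity. now apply sumn_le.
Qed.

Lemma sumn_swap n m f :
  sumn n (fun i => sumn m (fun j => f i j)) = sumn m (fun j => sumn n (fun i => f i j)).
Proof.
  induction n as [|n IH]; simpl.
  - symmetry. now apply sumn_zero.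
  - rewrite IH, <- sumn_plus. reflexivity.
Qed.

Lemma sumn_add n m f : sumn (n + m) f = sumn n f + sumn m (fun i => f (n + i)%nat).
Proof.
  induction m as [|m IH]; simpl; [rewrite Nat.add_0_r; lra|].
  rewrite Nat.add_succ_r. simpl. rewrite IH. lra.
Qed.

Lemma sumn_mult n m f g :
  sumn n f * sumn m g = sumn n (fun i => sumn m (fun j => f i * g j)).
Proof.
  rewrite Rmult_comm, <- sumn_scal. apply sumn_ext; intros.
  rewrite sumn_scal. ring.
Qed.

Lemma sumn_cauchy_schwarz n a b :
  (sumn n (fun i => a i * b i)) ^ 2 <= sumn n (fun i => a i ^ 2) * sumn n (fun i => b i ^ 2).
Proof.
  induction n as [|n IH]; [simpl; lra|].
  change (sumn (S n) (fun i => a i * b i)) with (sumn n (fun i => a i * b i) + a n * b n).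
  change (sumn (S n) (fun i => a i ^ 2)) with (sumn n (fun i => a i ^ 2) + a n ^ 2).
  change (sumn (S n) (fun i => b i ^ 2)) with (sumn n (fun i => b i ^ 2) + b n ^ 2).
  assert (HA : 0 <= sumn n (fun i => a i ^ 2)) by (apply sumn_nonneg; intros; nra).
  assert (HB : 0 <= sumn n (fun i => b i ^ 2)) by (apply sumn_nonneg; intros; nra).
  set (S0 := sumn n (fun i => a i * b i)) in *.
  set (A := sumn n (fun i => a i ^ 2)) in *. set (B := sumn n (fun i => b i ^ 2)) in *.
  set (x := a n). set (y := b n).
  (* The induction step reduces to this bound on the cross term. If it failed, squaring would
     contradict [S0 ^ 2 <= A * B] together with AM-GM for [A * y ^ 2] and [B * x ^ 2]. *)
  enough (2 * S0 * x * y <= A * y ^ 2 + B * x ^ 2) by nra.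
  assert (H0 : 0 <= A * y ^ 2 + B * x ^ 2) by nra.
  apply Rnot_lt_le; intros H.
  assert (H1 : (A * y ^ 2 + B * x ^ 2) ^ 2 < (2 * S0 * x * y) ^ 2) by nra.
  assert (H2 : 0 <= (A * y ^ 2 - B * x ^ 2) ^ 2) by apply pow2_ge_0.
  assert (H3 : S0 ^ 2 * (x * y) ^ 2 <= A * B * (x * y) ^ 2)
    by (apply Rmult_le_compat_r; [apply pow2_ge_0|exact IH]).
  nra.
Qed.

(** Cauchy-Schwarz bounds the cross term by [s * t]. Norms enter only through upper bounds [s] and
    [t], so that later uses work with squared norms and explicit radii. *)
Lemma sumn_minkowski n a b s t :
  0 <= s -> 0 <= t ->
  sumn n (fun i => a i ^ 2) <= s ^ 2 -> sumn n (fun i => b i ^ 2) <= t ^ 2 ->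
  sumn n (fun i => (a i + b i) ^ 2) <= (s + t) ^ 2.
Proof.
  intros Hs Ht Ha Hb.
  rewrite (sumn_ext n _ (fun i => (a i ^ 2 + b i ^ 2) + 2 * (a i * b i))) by (intros; ring).
  rewrite sumn_plus, sumn_plus, sumn_scal.
  pose proof (sumn_cauchy_schwarz n a b) as CS.
  assert (HA : 0 <= sumn n (fun i => a i ^ 2)) by (apply sumn_nonneg; intros; nra).
  assert (HB : 0 <= sumn n (fun i => b i ^ 2)) by (apply sumn_nonneg; intros; nra).
  assert (sumn n (fun i => a i * b i) <= s * t).
  { apply Rnot_lt_le; intros H.
    assert (0 <= s * t) by nra.
    assert ((s * t) ^ 2 < sumn n (fun i => a i * b i) ^ 2) by nra.
    assert (sumn n (fun i => a i ^ 2) * sumn n (fun i => b i ^ 2) <= s ^ 2 * t ^ 2)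
      by (apply Rmult_le_compat; assumption).
    nra. }
  nra.
Qed.

(** * Frobenius norms of tensor words *)

(* The squared Frobenius norm of the tensor sum_i nu_i u_1(i) (x) ... (x) u_l(i), for a word
   [u_1; ...; u_l] of letters; a letter assigns a vector of R^d to each atom index i < n. *)
Fixpoint wordNormSq (n d : nat) (W : list (nat -> nat -> R)) (nu : nat -> R) : R :=
  match W with
  | nil => (sumn n nu) ^ 2
  | u :: W' => sumn d (fun j => wordNormSq n d W' (fun i => nu i * u i j))
  end.

Lemma wordNormSq_ext n d W : forall nu nu', (forall i, (i < n)%nat -> nu i = nu' i) ->
  wordNormSq n d W nu = wordNormSq n d W nu'.
Proof.
  induction W as [|u W IH]; intros nu nu' H; simpl.
  - rewrite (sumn_ext n nu nu' H). reflexivity.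
  - apply sumn_ext; intros j _. apply IH. intros i Hi. now rewrite H.
Qed.

Lemma wordNormSq_nonneg n d W : forall nu, 0 <= wordNormSq n d W nu.
Proof.
  induction W as [|u W IH]; intros nu; simpl.
  - nra.
  - apply sumn_nonneg; intros; apply IH.
Qed.

Lemma wordNormSq_scal n d W : forall c nu,
  wordNormSq n d W (fun i => c * nu i) = c ^ 2 * wordNormSq n d W nu.
Proof.
  induction W as [|u W IH]; intros c nu; simpl wordNormSq.
  - rewrite sumn_scal. ring.
  - rewrite <- sumn_scal. apply sumn_ext; intros j _. rewrite <- IH.
    apply wordNormSq_ext; intros; ring.
Qed.

(** Triangle inequality of the Frobenius norm: by induction it holds on each slice of the first
    tensor index, and Minkowski assembles the slices. *)
Lemma wordNormSq_triangle n d W : forall nu nu' s t, 0 <= s -> 0 <= t ->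
  wordNormSq n d W nu <= s ^ 2 -> wordNormSq n d W nu' <= t ^ 2 ->
  wordNormSq n d W (fun i => nu i + nu' i) <= (s + t) ^ 2.
Proof.
  induction W as [|u W IH]; intros nu nu' s t Hs Ht H H'; simpl wordNormSq in *.
  - rewrite sumn_plus.
    assert (forall x y, 0 <= y -> x ^ 2 <= y ^ 2 -> - y <= x <= y) as L.
    { intros x y Hy Hxy. split; apply Rnot_lt_le; intros K; nra. }
    destruct (L _ _ Hs H). destruct (L _ _ Ht H'). nra.
  - set (a := fun j => sqrt (wordNormSq n d W (fun i => nu i * u i j))).
    set (b := fun j => sqrt (wordNormSq n d W (fun i => nu' i * u i j))).
    assert (Ha : forall j, a j ^ 2 = wordNormSq n d W (fun i => nu i * u i j))
      by (intros; apply pow2_sqrt, wordNormSq_nonneg).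
    assert (Hb : forall j, b j ^ 2 = wordNormSq n d W (fun i => nu' i * u i j))
      by (intros; apply pow2_sqrt, wordNormSq_nonneg).
    apply Rle_trans with (sumn d (fun j => (a j + b j) ^ 2)).
    + apply sumn_le; intros j _.
      rewrite (wordNormSq_ext n d W _ (fun i => nu i * u i j + nu' i * u i j)) by (intros; ring).
      apply IH; try apply sqrt_pos.
      * rewrite Ha. apply Rle_refl.
      * rewrite Hb. apply Rle_refl.
    + apply sumn_minkowski; try assumption.
      * erewrite sumn_ext; [exact H|]. intros; apply Ha.
      * erewrite sumn_ext; [exact H'|]. intros; apply Hb.
Qed.

(** Moving a letter only permutes the tensor indices. This allows any factor of a word to be treated
    as the first one. *)
Lemma wordNormSq_middle n d u W2 : forall W1 nu,
  wordNormSq n d (W1 ++ u :: W2) nu = wordNormSq n d (u :: W1 ++ W2) nu.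
Proof.
  induction W1 as [|v W1 IH]; intros nu; [reflexivity|].
  simpl app. simpl wordNormSq at 1 2.
  rewrite (sumn_ext d _ (fun j => sumn d (fun j' =>
     wordNormSq n d (W1 ++ W2) (fun i => nu i * v i j * u i j')))).
  - rewrite sumn_swap. apply sumn_ext; intros j _. apply sumn_ext; intros j' _.
    apply wordNormSq_ext; intros; ring.
  - intros j _. rewrite IH. reflexivity.
Qed.

(** The tensor is linear in its first letter, so splitting that letter costs one triangle
    inequality. *)
Lemma wordNormSq_letter_add n d u v v' W nu s t : 0 <= s -> 0 <= t ->
  (forall i j, u i j = v i j + v' i j) ->
  wordNormSq n d (v :: W) nu <= s ^ 2 -> wordNormSq n d (v' :: W) nu <= t ^ 2 ->
  wordNormSq n d (u :: W) nu <= (s + t) ^ 2.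
Proof.
  intros Hs Ht E H H'. simpl wordNormSq in *.
  set (a := fun j => sqrt (wordNormSq n d W (fun i => nu i * v i j))).
  set (b := fun j => sqrt (wordNormSq n d W (fun i => nu i * v' i j))).
  assert (Ha : forall j, a j ^ 2 = wordNormSq n d W (fun i => nu i * v i j))
    by (intros; apply pow2_sqrt, wordNormSq_nonneg).
  assert (Hb : forall j, b j ^ 2 = wordNormSq n d W (fun i => nu i * v' i j))
    by (intros; apply pow2_sqrt, wordNormSq_nonneg).
  apply Rle_trans with (sumn d (fun j => (a j + b j) ^ 2)).
  - apply sumn_le; intros j _.
    rewrite (wordNormSq_ext n d W _ (fun i => nu i * v i j + nu i * v' i j))
      by (intros; rewrite E; ring).
    apply wordNormSq_triangle; try apply sqrt_pos.
    + rewrite Ha. apply Rle_refl.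
    + rewrite Hb. apply Rle_refl.
  - apply sumn_minkowski; try assumption.
    + erewrite sumn_ext; [exact H|]. intros; apply Ha.
    + erewrite sumn_ext; [exact H'|]. intros; apply Hb.
Qed.

Lemma wordNormSq_letter_const n d c W nu :
  wordNormSq n d ((fun _ j => c j) :: W) nu = sqnorm d c * wordNormSq n d W nu.
Proof.
  simpl. unfold sqnorm. rewrite Rmult_comm, <- sumn_scal. apply sumn_ext; intros j _.
  rewrite (wordNormSq_ext n d W _ (fun i => c j * nu i)) by (intros; ring).
  rewrite wordNormSq_scal. ring.
Qed.

(** Each atom is killed by a factor vanishing there. The alternative [nu i = 0] carries the
    induction: once such a letter is consumed, the weight of the atom has become zero. *)
Lemma wordNormSq_eq0 n d : forall W nu,
  (forall i, (i < n)%nat -> nu i = 0 \/ exists u, In u W /\ forall j, u i j = 0) ->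
  wordNormSq n d W nu = 0.
Proof.
  induction W as [|v W IH]; intros nu H; simpl.
  - rewrite sumn_zero; [ring|]. intros i Hi. destruct (H i Hi) as [H0|[u [[] _]]]. exact H0.
  - apply sumn_zero; intros j _. apply IH. intros i Hi.
    destruct (H i Hi) as [H0|[u [[<-|Hu] Hz]]].
    + left. rewrite H0. ring.
    + left. rewrite Hz. ring.
    + right. exists u. auto.
Qed.

Lemma wordNormSq_repeat_tensor n d X : forall l nu,
  sumTuples d l (fun s => (sumn n (fun i => nu i * prodCoords (X i) s)) ^ 2)
  = wordNormSq n d (repeat X l) nu.
Proof.
  induction l as [|l IH]; intros nu.
  - simpl. rewrite (sumn_ext n _ nu) by (intros; ring). reflexivity.
  - simpl. apply sumn_ext; intros j _. rewrite <- IH.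
    assert (forall F G, (forall s, F s = G s) -> sumTuples d l F = sumTuples d l G) as Ext.
    { clear. induction l as [|l IH]; intros F G H; simpl; [apply H|].
      apply sumn_ext; intros; apply IH; intros; apply H. }
    apply Ext; intros s. simpl.
    rewrite (sumn_ext n _ (fun i => nu i * X i j * prodCoords (X i) s)) by (intros; ring).
    reflexivity.
Qed.

Definition dot (d : nat) (x y : nat -> R) : R := sumn d (fun j => x j * y j).

(** The inner product of two l-th tensor powers is the l-th power of the inner product. *)
Lemma wordNormSq_repeat_gram n d X : forall l nu,
  wordNormSq n d (repeat X l) nu
  = sumn n (fun i => sumn n (fun i' => nu i * nu i' * dot d (X i) (X i') ^ l)).
Proof.
  induction l as [|l IH]; intros nu.
  - simpl. rewrite Rmult_1_r, sumn_mult.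
    apply sumn_ext; intros; apply sumn_ext; intros; ring.
  - simpl.
    rewrite (sumn_ext d _ (fun j => sumn n (fun i => sumn n (fun i' =>
      nu i * X i j * (nu i' * X i' j) * dot d (X i) (X i') ^ l)))) by (intros; apply IH).
    rewrite sumn_swap. apply sumn_ext; intros i _.
    rewrite sumn_swap. apply sumn_ext; intros i' _.
    rewrite (sumn_ext d _ (fun j => (nu i * nu i' * dot d (X i) (X i') ^ l) * (X i j * X i' j)))
      by (intros; ring).
    rewrite sumn_scal. unfold dot. ring.
Qed.

(** * Newton interpolation on the atoms *)

Definition shiftLetter (X : nat -> nat -> R) (c : nat -> R) : nat -> nat -> R :=
  fun i j => X i j - c j.

(** Tensor analogue of the Newton basis polynomial with nodes [X 0], ..., [X (p - 1)]. *)
Fixpoint newtonWord (X : nat -> nat -> R) (p : nat) : list (nat -> nat -> R) :=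
  match p with O => nil | S p' => shiftLetter X (X p') :: newtonWord X p' end.

Lemma newtonWord_In X p q : (q < p)%nat -> In (shiftLetter X (X q)) (newtonWord X p).
Proof.
  induction p as [|p IH]; intros H; [lia|]. simpl.
  destruct (Nat.eq_dec p q) as [->|]; [now left|right; apply IH; lia].
Qed.

Lemma sqnorm_nonneg d x : 0 <= sqnorm d x.
Proof. apply sumn_nonneg; intros; nra. Qed.

Lemma sqnorm_sub d x y r s : 0 <= r -> 0 <= s -> sqnorm d x <= r ^ 2 -> sqnorm d y <= s ^ 2 ->
  sqnorm d (fun j => x j - y j) <= (r + s) ^ 2.
Proof.
  unfold sqnorm. intros Hr Hs Hx Hy.
  rewrite (sumn_ext d _ (fun j => (x j + - y j) ^ 2)) by (intros; ring).
  apply sumn_minkowski; try assumption.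
  - rewrite (sumn_ext d _ (fun j => x j * x j)) by (intros; ring). exact Hx.
  - rewrite (sumn_ext d _ (fun j => y j * y j)) by (intros; ring). exact Hy.
Qed.

Section MomentGrowth.

Variables (n d : nat) (X : nat -> nat -> R) (nu : nat -> R) (r m : R).
Hypothesis r_ge0 : 0 <= r.
Hypothesis m_ge0 : 0 <= m.
Hypothesis X_le : forall i, (i < n)%nat -> sqnorm d (X i) <= r ^ 2.
Hypothesis moments_le : forall l, (l < n)%nat -> wordNormSq n d (repeat X l) nu <= m ^ 2.

(** Expanding the factor x - X_p either adds one more plain letter [X] or contributes a constant
    vector of length at most r, hence [1 + r] per factor. The sum [p + t] never grows, so only
    moments of order below n occur. *)
Lemma newton_le : forall p t, (p + t < n)%nat ->
  wordNormSq n d (repeat X t ++ newtonWord X p) nu <= ((1 + r) ^ p * m) ^ 2.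
Proof.
  induction p as [|p IH]; intros t Ht; simpl newtonWord.
  - rewrite app_nil_r. simpl pow at 2. rewrite Rmult_1_l. apply moments_le; lia.
  - rewrite wordNormSq_middle.
    assert (Hp : 0 <= (1 + r) ^ p * m) by (apply Rmult_le_pos; [apply pow_le; lra|assumption]).
    replace ((1 + r) ^ S p * m) with ((1 + r) ^ p * m + r * ((1 + r) ^ p * m)) by (simpl; ring).
    apply wordNormSq_letter_add with (v := X) (v' := fun _ j => - X p j).
    + exact Hp.
    + apply Rmult_le_pos; assumption.
    + intros; unfold shiftLetter; ring.
    + apply (IH (S t)); lia.
    + rewrite wordNormSq_letter_const, Rpow_mult_distr.
      apply Rmult_le_compat; [apply sqnorm_nonneg|apply wordNormSq_nonneg| |apply IH; lia].
      unfold sqnorm. rewrite (sumn_ext d _ (fun j => X p j * X p j)) by (intros; ring).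
      apply X_le; lia.
Qed.

(* A word containing all the letters x - X_q, q < n, vanishes at every atom, so each factor
   x - c = (x - X_p) + (X_p - c) either extends the Newton word, at most n times, or
   contributes a constant vector of length at most 2 r. *)
Lemma shifted_newton_le c : sqnorm d c <= r ^ 2 -> forall l p, (p <= n)%nat ->
  wordNormSq n d (repeat (shiftLetter X c) l ++ newtonWord X p) nu
  <= ((1 + r) ^ p * (1 + 3 * r) ^ l * m) ^ 2.
Proof.
  intros Hc. induction l as [|l IH]; intros p Hp.
  - destruct (Nat.eq_dec p n) as [->|Hn].
    + rewrite wordNormSq_eq0; [apply pow2_ge_0|].
      intros i Hi. right. exists (shiftLetter X (X i)). split.
      * apply newtonWord_In; assumption.
      * intros; unfold shiftLetter; ring.
    + pose proof (newton_le p 0) as H. simpl repeat in *. simpl app in *.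
      replace ((1 + r) ^ p * (1 + 3 * r) ^ 0 * m) with ((1 + r) ^ p * m) by (simpl; ring).
      apply H; lia.
  - destruct (Nat.eq_dec p n) as [->|Hn].
    + rewrite wordNormSq_eq0; [apply pow2_ge_0|].
      intros i Hi. right. exists (shiftLetter X (X i)). split.
      * apply in_or_app; right. apply newtonWord_In; assumption.
      * intros; unfold shiftLetter; ring.
    + set (b := (1 + r) ^ p * (1 + 3 * r) ^ l * m).
      assert (Hb : 0 <= b).
      { unfold b. repeat apply Rmult_le_pos; try apply pow_le; lra. }
      (* Extending the Newton word costs [1 + r] and the constant vector X_p - c costs [2 * r];
         together they give the factor [1 + 3 * r]. *)
      replace ((1 + r) ^ p * (1 + 3 * r) ^ S l * m)
        with ((1 + r) * b + (r + r) * b) by (unfold b; simpl; ring).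
      simpl repeat. simpl app.
      apply wordNormSq_letter_add
        with (v := shiftLetter X (X p)) (v' := fun _ j => X p j - c j).
      * nra.
      * nra.
      * intros; unfold shiftLetter; ring.
      * rewrite <- wordNormSq_middle.
        replace ((1 + r) * b) with ((1 + r) ^ S p * (1 + 3 * r) ^ l * m)
          by (unfold b; simpl; ring).
        apply (IH (S p)); lia.
      * rewrite wordNormSq_letter_const, Rpow_mult_distr.
        apply Rmult_le_compat; [apply sqnorm_nonneg|apply wordNormSq_nonneg| |apply IH; lia].
        apply sqnorm_sub; try assumption. apply X_le; lia.
Qed.

Lemma shifted_moment_le c l : sqnorm d c <= r ^ 2 ->
  wordNormSq n d (repeat (shiftLetter X c) l) nu <= ((1 + 3 * r) ^ 2) ^ l * m ^ 2.
Proof.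
  intros Hc. pose proof (shifted_newton_le c Hc l 0 (Nat.le_0_l _)) as H.
  simpl newtonWord in H. rewrite app_nil_r in H.
  eapply Rle_trans; [exact H|]. right.
  rewrite <- pow_mult, (Nat.mul_comm 2 l), pow_mult. simpl. ring.
Qed.

End MomentGrowth.

(* Q(c) = sum_{i,i'} nu_i nu_i' exp <X_i - c, X_i' - c>, the squared norm of
   sum_i nu_i N(X_i, I) in L^2 of the reciprocal of the density of N(c, I). *)
Definition expForm (n d : nat) (X : nat -> nat -> R) (nu : nat -> R) (c : nat -> R) : R :=
  sumn n (fun i => sumn n (fun i' =>
    nu i * nu i' * exp (dot d (shiftLetter X c i) (shiftLetter X c i')))).

(** * Power series of the exponential form *)

Lemma is_series_sumn n (a : nat -> nat -> R) (s : nat -> R) :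
  (forall i, (i < n)%nat -> is_series (a i) (s i)) ->
  is_series (fun l => sumn n (fun i => a i l)) (sumn n s).
Proof.
  induction n as [|n IH]; intros H; simpl.
  - assert (H0 : is_lim_seq (sum_n (fun _ : nat => 0)) 0); [|exact H0].
    apply (is_lim_seq_ext (fun _ => 0)); [|apply is_lim_seq_const].
    intros N. rewrite sum_n_const. ring.
  - apply (is_series_plus (fun l => sumn n (fun i => a i l)) (a n)).
    + apply IH; intros; apply H; lia.
    + apply H; lia.
Qed.

Lemma is_series_exp x : is_series (fun l => x ^ l / INR (fact l)) (exp x).
Proof.
  pose proof (is_exp_Reals x) as H. unfold is_pseries in H.
  eapply is_series_ext; [|exact H]. intros l.
  rewrite pow_n_pow. unfold scal; simpl; unfold mult; simpl. unfold Rdiv. reflexivity.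
Qed.

Lemma is_series_Rmult_l c (a : nat -> R) (s : R) :
  is_series a s -> is_series (fun l => c * a l) (c * s).
Proof. intros H. exact (is_series_scal (V := R_NormedModule) c a s H). Qed.

(** Each exponential is expanded, and the Gram identity collects the terms of order l. *)
Lemma expForm_series n d X nu c :
  is_series (fun l => wordNormSq n d (repeat (shiftLetter X c) l) nu / INR (fact l))
            (expForm n d X nu c).
Proof.
  unfold expForm.
  eapply is_series_ext; [|apply is_series_sumn; intros i _; apply is_series_sumn; intros i' _;
    apply is_series_Rmult_l, is_series_exp].
  intros l. simpl. rewrite wordNormSq_repeat_gram.
  unfold Rdiv. rewrite Rmult_comm, <- sumn_scal. apply sumn_ext; intros i _.
  rewrite <- sumn_scal. apply sumn_ext; intros i' _.
  unfold Rdiv. ring.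
Qed.

Lemma is_series_le a b la lb : (forall l, a l <= b l) ->
  is_series a la -> is_series b lb -> la <= lb.
Proof.
  intros H Ha Hb.
  apply (is_lim_seq_le (sum_n a) (sum_n b) la lb).
  - intros N. apply sum_n_m_le; exact H.
  - exact Ha.
  - exact Hb.
Qed.

Lemma expForm_le n d X nu r m c : 0 <= r -> 0 <= m ->
  (forall i, (i < n)%nat -> sqnorm d (X i) <= r ^ 2) ->
  (forall l, (l < n)%nat -> wordNormSq n d (repeat X l) nu <= m ^ 2) ->
  sqnorm d c <= r ^ 2 ->
  expForm n d X nu c <= exp ((1 + 3 * r) ^ 2) * m ^ 2.
Proof.
  intros Hr Hm HX HM Hc.
  eapply is_series_le; [|apply expForm_series|].
  2:{ rewrite Rmult_comm. apply is_series_Rmult_l, is_series_exp. }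
  intros l. simpl. unfold Rdiv. rewrite <- Rmult_assoc. apply Rmult_le_compat_r.
  - apply Rlt_le, Rinv_0_lt_compat, INR_fact_lt_0.
  - pose proof (shifted_moment_le n d X nu r m Hr Hm HX HM c l Hc). simpl in *. lra.
Qed.

(** All terms of the series are nonnegative, so any single one bounds the sum from below. *)
Lemma expForm_ge n d X nu c l :
  wordNormSq n d (repeat (shiftLetter X c) l) nu / INR (fact l) <= expForm n d X nu c.
Proof.
  set (a := fun l => wordNormSq n d (repeat (shiftLetter X c) l) nu / INR (fact l)).
  assert (Ha : forall l, 0 <= a l).
  { intros l'. apply Rmult_le_pos; [apply wordNormSq_nonneg|].
    apply Rlt_le, Rinv_0_lt_compat, INR_fact_lt_0. }
  apply Rle_trans with (sum_n a l).
  - change (a l <= sum_n a l). destruct l as [|l]; [rewrite sum_O; lra|].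
    rewrite sum_Sn. unfold plus; simpl.
    assert (0 <= sum_n a l); [|lra].
    rewrite <- (Rmult_0_r (INR (S l))), <- (sum_n_const l 0). apply sum_n_m_le; exact Ha.
  - apply (is_lim_seq_incr_compare (sum_n a)).
    + exact (expForm_series n d X nu c).
    + intros N. rewrite sum_Sn. unfold plus; simpl. specialize (Ha (S N)). lra.
Qed.

(** * Iterated integrals over cubes *)

Definition inCube (d : nat) (M : R) (x : nat -> R) : Prop :=
  forall j, (j < d)%nat -> Rabs (x j) <= M.

(** Boundedness and uniform continuity on every cube, measured in the first d coordinates only; in
    particular f cannot depend on the others. The uniform modulus is what makes slice integrals
    continuous. *)
Definition cubeContinuous (d : nat) (f : (nat -> R) -> R) : Prop :=
  forall M,
    (exists B, forall x, inCube d M x -> Rabs (f x) <= B) /\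
    (forall eps, 0 < eps -> exists delta, 0 < delta /\
       forall x y, inCube d M x -> inCube d M y ->
         (forall j, (j < d)%nat -> Rabs (x j - y j) < delta) -> Rabs (f x - f y) < eps).

Lemma cubeContinuous_ext d f g : (forall x, f x = g x) ->
  cubeContinuous d f -> cubeContinuous d g.
Proof.
  intros E H M. destruct (H M) as [[B HB] HU]. split.
  - exists B. intros x Hx. rewrite <- E. auto.
  - intros eps He. destruct (HU eps He) as [delta [Hd HD]]. exists delta. split; auto.
    intros x y Hx Hy Hxy. rewrite <- !E. auto.
Qed.

Lemma cubeContinuous_const d c : cubeContinuous d (fun _ => c).
Proof.
  intros M. split.
  - exists (Rabs c). intros; lra.
  - intros eps He. exists 1. split; [lra|]. intros. rewrite Rminus_diag, Rabs_R0. exact He.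
Qed.

Lemma cubeContinuous_coord d j : (j < d)%nat -> cubeContinuous d (fun x => x j).
Proof.
  intros Hj M. split.
  - exists M. intros x Hx. apply Hx; assumption.
  - intros eps He. exists eps. split; auto.
Qed.

Lemma cubeContinuous_plus d f g : cubeContinuous d f -> cubeContinuous d g ->
  cubeContinuous d (fun x => f x + g x).
Proof.
  intros Hf Hg M. destruct (Hf M) as [[B HB] HU]. destruct (Hg M) as [[B' HB'] HU']. split.
  - exists (B + B'). intros x Hx. eapply Rle_trans; [apply Rabs_triang|].
    apply Rplus_le_compat; auto.
  - intros eps He.
    destruct (HU (eps / 2)) as [de [Hd HD]]; [lra|].
    destruct (HU' (eps / 2)) as [de' [Hd' HD']]; [lra|].
    exists (Rmin de de'). split; [apply Rmin_pos; assumption|].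
    intros x y Hx Hy Hxy.
    replace (f x + g x - (f y + g y)) with ((f x - f y) + (g x - g y)) by ring.
    eapply Rle_lt_trans; [apply Rabs_triang|].
    assert (Rabs (f x - f y) < eps / 2).
    { apply HD; auto. intros j Hj. eapply Rlt_le_trans; [apply Hxy; assumption|apply Rmin_l]. }
    assert (Rabs (g x - g y) < eps / 2).
    { apply HD'; auto. intros j Hj. eapply Rlt_le_trans; [apply Hxy; assumption|apply Rmin_r]. }
    lra.
Qed.

(** Only an interval containing the values of f on the cube matters, which admits functions such as
    [ln] and [Rinv] on positive f. *)
Lemma cubeContinuous_comp d psi f : cubeContinuous d f ->
  (forall M, exists a b, a <= b /\ (forall x, inCube d M x -> a <= f x <= b) /\
     (forall y, a <= y <= b -> continuity_pt psi y)) ->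
  cubeContinuous d (fun x => psi (f x)).
Proof.
  intros Hf Hpsi M. destruct (Hf M) as [_ HU]. destruct (Hpsi M) as [a [b [Hab [HR HC]]]]. split.
  - destruct (continuity_ab_maj psi a b Hab HC) as [y1 [H1 _]].
    destruct (continuity_ab_min psi a b Hab HC) as [y2 [H2 _]].
    exists (Rmax (psi y1) (- psi y2)). intros x Hx.
    specialize (H1 _ (HR x Hx)). specialize (H2 _ (HR x Hx)).
    apply Rabs_le. split.
    + pose proof (Rmax_r (psi y1) (- psi y2)). lra.
    + pose proof (Rmax_l (psi y1) (- psi y2)). lra.
  - intros eps He. destruct (@Heine_cor2 psi a b HC (mkposreal eps He)) as [d1 H1].
    destruct (HU d1 (cond_pos d1)) as [de [Hd HD]].
    exists de. split; [assumption|]. intros x y Hx Hy Hxy.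
    apply H1; auto.
Qed.

Lemma cubeContinuous_comp_continuous d psi f : cubeContinuous d f -> continuity psi ->
  cubeContinuous d (fun x => psi (f x)).
Proof.
  intros Hf Hpsi. apply cubeContinuous_comp; [assumption|]. intros M.
  destruct (Hf M) as [[B HB] _]. exists (- Rabs B), (Rabs B).
  split; [pose proof (Rabs_pos B); lra|]. split; [|intros; apply Hpsi].
  intros x Hx. apply Rabs_le_between. eapply Rle_trans; [apply HB; assumption|apply Rle_abs].
Qed.

Lemma cubeContinuous_scal d c f : cubeContinuous d f -> cubeContinuous d (fun x => c * f x).
Proof.
  intros Hf. apply (cubeContinuous_comp_continuous d (fun y => c * y)); [assumption|].
  intros y. apply derivable_continuous_pt. reg.
Qed.

Lemma cubeContinuous_sqr d f : cubeContinuous d f -> cubeContinuous d (fun x => f x ^ 2).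
Proof.
  intros Hf. apply (cubeContinuous_comp_continuous d (fun y => y ^ 2)); [assumption|].
  intros y. apply derivable_continuous_pt. reg.
Qed.

Lemma cubeContinuous_minus d f g : cubeContinuous d f -> cubeContinuous d g ->
  cubeContinuous d (fun x => f x - g x).
Proof.
  intros Hf Hg. apply (cubeContinuous_ext d (fun x => f x + (-1) * g x)); [intros; ring|].
  apply cubeContinuous_plus; [assumption|now apply cubeContinuous_scal].
Qed.

(** Polarization reduces products to sums and squares. *)
Lemma cubeContinuous_mult d f g : cubeContinuous d f -> cubeContinuous d g ->
  cubeContinuous d (fun x => f x * g x).
Proof.
  intros Hf Hg.
  apply (cubeContinuous_ext d (fun x => / 4 * ((f x + g x) ^ 2 - (f x - g x) ^ 2)));
    [intros; field|].
  apply cubeContinuous_scal, cubeContinuous_minus; apply cubeContinuous_sqr.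
  - now apply cubeContinuous_plus.
  - now apply cubeContinuous_minus.
Qed.

Lemma cubeContinuous_sumn d n F : (forall i, (i < n)%nat -> cubeContinuous d (F i)) ->
  cubeContinuous d (fun x => sumn n (fun i => F i x)).
Proof.
  induction n as [|n IH]; intros H; simpl; [apply cubeContinuous_const|].
  apply cubeContinuous_plus; [apply IH; intros; apply H; lia|apply H; lia].
Qed.

Definition cubePositive (d : nat) (f : (nat -> R) -> R) : Prop :=
  forall M, exists a, 0 < a /\ forall x, inCube d M x -> a <= f x.

Lemma cubeContinuous_comp_pos d psi f : cubeContinuous d f -> cubePositive d f ->
  (forall y, 0 < y -> continuity_pt psi y) -> cubeContinuous d (fun x => psi (f x)).
Proof.
  intros Hf Hp Hpsi. apply cubeContinuous_comp; [assumption|]. intros M.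
  destruct (Hf M) as [[B HB] _]. destruct (Hp M) as [a [Ha HA]].
  exists a, (Rmax a B). split; [apply Rmax_l|]. split; [|intros; apply Hpsi; lra].
  intros x Hx. split; [auto|]. eapply Rle_trans; [|apply Rmax_r].
  eapply Rle_trans; [apply Rle_abs|auto].
Qed.

Lemma upd_eq x j t : upd x j t j = t.
Proof. unfold upd. now rewrite Nat.eqb_refl. Qed.

Lemma upd_neq x j t i : i <> j -> upd x j t i = x i.
Proof. intros H. unfold upd. apply Nat.eqb_neq in H. now rewrite H. Qed.

Lemma inCube_upd d M x t : inCube d M x -> Rabs t <= M -> inCube (S d) M (upd x d t).
Proof.
  intros Hx Ht j Hj. destruct (Nat.eq_dec j d) as [->|Hn].
  - now rewrite upd_eq.
  - rewrite upd_neq by assumption. apply Hx; lia.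
Qed.

Lemma inCube_le d M M' x : M <= M' -> inCube d M x -> inCube d M' x.
Proof. intros H Hx j Hj. eapply Rle_trans; [apply Hx; assumption|assumption]. Qed.

Lemma cubeContinuous_slice d f t : cubeContinuous (S d) f ->
  cubeContinuous d (fun x => f (upd x d t)).
Proof.
  intros H M. destruct (H (Rmax M (Rabs t))) as [[B HB] HU].
  assert (HC : forall x, inCube d M x -> inCube (S d) (Rmax M (Rabs t)) (upd x d t)).
  { intros x Hx. apply inCube_upd; [|apply Rmax_r].
    eapply inCube_le; [apply Rmax_l|exact Hx]. }
  split.
  - exists B. auto.
  - intros eps He. destruct (HU eps He) as [de [Hd HD]]. exists de. split; [assumption|].
    intros x y Hx Hy Hxy. apply HD; auto.
    intros j Hj. destruct (Nat.eq_dec j d) as [->|Hn].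
    + rewrite !upd_eq, Rminus_diag, Rabs_R0. exact Hd.
    + rewrite !upd_neq by assumption. apply Hxy; lia.
Qed.

(** Functional counterpart of the relation [IntCube]; [IntCube_cubeInt] links the two. *)
Fixpoint cubeInt (N : R) (d : nat) (f : (nat -> R) -> R) : R :=
  match d with
  | O => f (fun _ => 0)
  | S d' => RInt (fun t => cubeInt N d' (fun x => f (upd x d' t))) (- N) N
  end.

Definition sliceInt (N : R) (d : nat) (f : (nat -> R) -> R) (t : R) : R :=
  cubeInt N d (fun x => f (upd x d t)).

(** The comparison estimate in dimension d is a hypothesis here because the two facts are proved in
    alternation: comparison in dimension d + 1 needs slice integrals to be integrable, and their
    continuity needs comparison in dimension d. *)
Lemma continuous_sliceInt_aux N d f : 0 <= N -> cubeContinuous (S d) f ->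
  (forall g h eps, 0 <= eps -> cubeContinuous d g -> cubeContinuous d h ->
     (forall x, inCube d N x -> g x <= h x + eps) ->
     cubeInt N d g <= cubeInt N d h + eps * (2 * N) ^ d) ->
  forall t, continuous (sliceInt N d f) t.
Proof.
  intros HN Hf Hest t.
  apply continuity_pt_filterlim. intros eps He.
  (* The added 1 keeps [K] positive and makes [eps / K * (2 * N) ^ d] strictly smaller than
     [eps]. *)
  set (K := (2 * N) ^ d + 1).
  assert (HK0 : 0 <= (2 * N) ^ d) by (apply pow_le; lra).
  assert (HK : 0 < K) by (unfold K; lra).
  (* This cube contains the slices at t and at every s with |s - t| < 1. *)
  destruct (Hf (Rmax N (Rabs t + 1))) as [_ HU].
  destruct (HU (eps / K)) as [de [Hd HD]]; [apply Rdiv_lt_0_compat; lra|].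
  exists (Rmin de 1). split; [apply Rmin_pos; lra|].
  intros s [_ Hs]. simpl in *. unfold R_dist in *.
  assert (Hs1 : Rabs (s - t) < de) by (eapply Rlt_le_trans; [exact Hs|apply Rmin_l]).
  assert (Hs2 : Rabs (s - t) < 1) by (eapply Rlt_le_trans; [exact Hs|apply Rmin_r]).
  assert (Hcl : forall u u' x, Rabs u <= Rabs t + 1 -> Rabs u' <= Rabs t + 1 ->
     Rabs (u - u') < de -> inCube d N x ->
     f (upd x d u) <= f (upd x d u') + eps / K).
  { intros u u' x Hu Hu' Huu Hx.
    assert (Rabs (f (upd x d u) - f (upd x d u')) < eps / K) as H.
    { apply HD.
      - apply inCube_upd; [|eapply Rle_trans; [exact Hu|apply Rmax_r]].
        eapply inCube_le; [apply Rmax_l|exact Hx].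
      - apply inCube_upd; [|eapply Rle_trans; [exact Hu'|apply Rmax_r]].
        eapply inCube_le; [apply Rmax_l|exact Hx].
      - intros j Hj. destruct (Nat.eq_dec j d) as [->|Hn].
        + now rewrite !upd_eq.
        + rewrite !upd_neq by assumption. now rewrite Rminus_diag, Rabs_R0. }
    apply Rabs_lt_between in H. lra. }
  assert (Hst : Rabs s <= Rabs t + 1).
  { replace s with (t + (s - t)) by ring. eapply Rle_trans; [apply Rabs_triang|]. lra. }
  assert (Htt : Rabs t <= Rabs t + 1) by lra.
  assert (HeK : 0 <= eps / K) by (apply Rlt_le, Rdiv_lt_0_compat; lra).
  pose proof (Hest _ _ _ HeK (cubeContinuous_slice d f s Hf) (cubeContinuous_slice d f t Hf)
    (fun x Hx => Hcl s t x Hst Htt Hs1 Hx)) as H1.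
  pose proof (Hest _ _ _ HeK (cubeContinuous_slice d f t Hf) (cubeContinuous_slice d f s Hf)
    (fun x Hx => Hcl t s x Htt Hst ltac:(rewrite Rabs_minus_sym; exact Hs1) Hx)) as H2.
  assert (Hlt : eps / K * (2 * N) ^ d < eps).
  { assert (0 < eps / K) by (apply Rdiv_lt_0_compat; lra).
    replace (eps / K * (2 * N) ^ d) with (eps - eps / K) by (unfold K; field; unfold K in HK; lra).
    lra. }
  unfold sliceInt. apply Rabs_def1; lra.
Qed.

(** The factor [(2 * N) ^ d] is the volume of the cube. Positive [eps] yields continuity of slice
    integrals, and [eps = 0] yields monotonicity. *)
Lemma cubeInt_le_eps N d : 0 <= N -> forall f g eps, 0 <= eps ->
  cubeContinuous d f -> cubeContinuous d g ->
  (forall x, inCube d N x -> f x <= g x + eps) ->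
  cubeInt N d f <= cubeInt N d g + eps * (2 * N) ^ d.
Proof.
  intros HN. induction d as [|d IH]; intros f g eps He Hf Hg H.
  - simpl. rewrite Rmult_1_r. apply H. intros j Hj. lia.
  - assert (Cf : ex_RInt (sliceInt N d f) (- N) N)
      by (apply (@ex_RInt_continuous R_CompleteNormedModule); intros;
          apply continuous_sliceInt_aux; auto).
    assert (Cg : ex_RInt (sliceInt N d g) (- N) N)
      by (apply (@ex_RInt_continuous R_CompleteNormedModule); intros;
          apply continuous_sliceInt_aux; auto).
    change (RInt (sliceInt N d f) (- N) N <=
            RInt (sliceInt N d g) (- N) N + eps * (2 * N) ^ S d).
    replace (RInt (sliceInt N d g) (- N) N + eps * (2 * N) ^ S d)
      with (RInt (fun t => plus (sliceInt N d g t) (eps * (2 * N) ^ d)) (- N) N).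
    + apply RInt_le; [lra|exact Cf| |].
      * apply (ex_RInt_plus (V := R_NormedModule)); [exact Cg|apply ex_RInt_const].
      * intros t Ht. unfold plus; simpl. unfold sliceInt.
        apply IH; auto using cubeContinuous_slice.
        intros x Hx. apply H. apply inCube_upd; [assumption|]. apply Rabs_le. lra.
    + rewrite (RInt_plus (V := R_CompleteNormedModule)); [|exact Cg|apply ex_RInt_const].
      rewrite RInt_const. unfold plus, scal; simpl; unfold mult; simpl. ring.
Qed.

Lemma continuous_sliceInt N d f t : 0 <= N -> cubeContinuous (S d) f ->
  continuous (sliceInt N d f) t.
Proof.
  intros HN Hf. apply continuous_sliceInt_aux; auto. intros. now apply cubeInt_le_eps.
Qed.

Lemma ex_RInt_sliceInt N d f a b : 0 <= N -> cubeContinuous (S d) f ->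
  ex_RInt (sliceInt N d f) a b.
Proof.
  intros HN Hf. apply (@ex_RInt_continuous R_CompleteNormedModule). intros.
  now apply continuous_sliceInt.
Qed.

Lemma cubeInt_le N d f g : 0 <= N -> cubeContinuous d f -> cubeContinuous d g ->
  (forall x, f x <= g x) -> cubeInt N d f <= cubeInt N d g.
Proof.
  intros HN Hf Hg H.
  pose proof (cubeInt_le_eps N d HN f g 0 (Rle_refl 0) Hf Hg) as K.
  rewrite Rmult_0_l, Rplus_0_r in K. apply K. intros. rewrite Rplus_0_r. apply H.
Qed.

Lemma cubeInt_ext N d : forall f g, (forall x, f x = g x) -> cubeInt N d f = cubeInt N d g.
Proof.
  induction d as [|d IH]; intros f g H; simpl; [apply H|].
  apply RInt_ext. intros t _. apply IH. intros; apply H.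
Qed.

Lemma cubeInt_nonneg N d f : 0 <= N -> cubeContinuous d f -> (forall x, 0 <= f x) ->
  0 <= cubeInt N d f.
Proof.
  intros HN. revert f. induction d as [|d IH]; intros f Hf H; simpl; [apply H|].
  apply RInt_ge_0; [lra| |].
  - apply (ex_RInt_sliceInt N d f); assumption.
  - intros t _. apply IH; [now apply cubeContinuous_slice|intros; apply H].
Qed.

Lemma cubeInt_scal N d c : 0 <= N -> forall f, cubeContinuous d f ->
  cubeInt N d (fun x => c * f x) = c * cubeInt N d f.
Proof.
  intros HN. induction d as [|d IH]; intros f Hf; simpl; [reflexivity|].
  rewrite (RInt_ext _ (fun t => scal c (sliceInt N d f t))).
  - rewrite (RInt_scal (V := R_CompleteNormedModule));
      [reflexivity|now apply ex_RInt_sliceInt].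
  - intros t _. unfold sliceInt. rewrite IH; [reflexivity|now apply cubeContinuous_slice].
Qed.

Lemma cubeInt_plus N d : 0 <= N -> forall f g, cubeContinuous d f -> cubeContinuous d g ->
  cubeInt N d (fun x => f x + g x) = cubeInt N d f + cubeInt N d g.
Proof.
  intros HN. induction d as [|d IH]; intros f g Hf Hg; simpl; [reflexivity|].
  rewrite (RInt_ext _ (fun t => plus (sliceInt N d f t) (sliceInt N d g t))).
  - rewrite (RInt_plus (V := R_CompleteNormedModule));
      [reflexivity|now apply ex_RInt_sliceInt|now apply ex_RInt_sliceInt].
  - intros t _. unfold sliceInt. rewrite IH; [reflexivity| |]; now apply cubeContinuous_slice.
Qed.

Lemma cubeInt_incr N N' d : 0 <= N <= N' -> forall f, cubeContinuous d f ->
  (forall x, 0 <= f x) -> cubeInt N d f <= cubeInt N' d f.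
Proof.
  intros [HN HN']. assert (HN0 : 0 <= N') by lra.
  induction d as [|d IH]; intros f Hf H; [simpl; lra|].
  change (RInt (sliceInt N d f) (- N) N <= RInt (sliceInt N' d f) (- N') N').
  set (h := sliceInt N' d f).
  assert (Hex : forall a b, ex_RInt h a b) by (intros; now apply ex_RInt_sliceInt).
  assert (Hpos : forall t, 0 <= h t).
  { intros t. apply cubeInt_nonneg; auto. now apply cubeContinuous_slice. }
  (* The inner cube is enlarged first, by induction, and then the outer interval, by Chasles. *)
  apply Rle_trans with (RInt h (- N) N).
  - apply RInt_le; [lra|now apply ex_RInt_sliceInt|apply Hex|].
    intros t _. apply IH; [now apply cubeContinuous_slice|intros; apply H].
  - rewrite <- (RInt_Chasles h (- N') (- N) N') by apply Hex.
    rewrite <- (RInt_Chasles h (- N) N N') by apply Hex.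
    assert (0 <= RInt h (- N') (- N)) by (apply RInt_ge_0; [lra|apply Hex|auto]).
    assert (0 <= RInt h N N') by (apply RInt_ge_0; [lra|apply Hex|auto]).
    unfold plus; simpl. lra.
Qed.

Lemma IntCube_cubeInt N d : 0 <= N -> forall f, cubeContinuous d f ->
  IntCube N d f (cubeInt N d f).
Proof.
  intros HN. induction d as [|d IH]; intros f Hf; [reflexivity|].
  exists (sliceInt N d f). split.
  - intros t. apply IH. now apply cubeContinuous_slice.
  - exists (ex_RInt_Reals_0 _ _ _ (ex_RInt_sliceInt N d f (- N) N HN Hf)).
    rewrite <- RInt_Reals. reflexivity.
Qed.

(** * Integrals over R^d as limits over growing cubes *)

Definition isIntRd (d : nat) (f : (nat -> R) -> R) (v : R) : Prop :=
  cubeContinuous d f /\ is_lim_seq (fun N => cubeInt (INR N) d f) v.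

Lemma IntRd_isIntRd d f v : isIntRd d f v -> IntRd d f v.
Proof.
  intros [Hf Hv]. exists (fun N => cubeInt (INR N) d f). split.
  - intros N. apply IntCube_cubeInt; [apply pos_INR|assumption].
  - now apply is_lim_seq_Reals.
Qed.

Lemma isIntRd_ext d f g v : (forall x, f x = g x) -> isIntRd d f v -> isIntRd d g v.
Proof.
  intros E [Hf Hv]. split; [eapply cubeContinuous_ext; eassumption|].
  eapply is_lim_seq_ext; [|exact Hv]. intros N. now apply cubeInt_ext.
Qed.

Lemma isIntRd_plus d f g u v : isIntRd d f u -> isIntRd d g v ->
  isIntRd d (fun x => f x + g x) (u + v).
Proof.
  intros [Hf Hu] [Hg Hv]. split; [now apply cubeContinuous_plus|].
  eapply is_lim_seq_ext; [|apply (is_lim_seq_plus' _ _ _ _ Hu Hv)].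
  intros N. symmetry. apply cubeInt_plus; auto using pos_INR.
Qed.

Lemma isIntRd_scal d c f u : isIntRd d f u -> isIntRd d (fun x => c * f x) (c * u).
Proof.
  intros [Hf Hu]. split; [now apply cubeContinuous_scal|].
  eapply is_lim_seq_ext; [|apply (is_lim_seq_scal_l _ c _ Hu)].
  intros N. symmetry. apply cubeInt_scal; auto using pos_INR.
Qed.

Lemma isIntRd_0 d : isIntRd d (fun _ => 0) 0.
Proof.
  split; [apply cubeContinuous_const|].
  eapply is_lim_seq_ext; [|apply is_lim_seq_const]. intros N.
  induction d as [|d IH]; simpl; [reflexivity|].
  rewrite (RInt_ext _ (fun _ => 0)) by (intros; symmetry; exact IH).
  rewrite RInt_const. unfold scal; simpl; unfold mult; simpl. ring.
Qed.

Lemma isIntRd_sumn d n F V : (forall i, (i < n)%nat -> isIntRd d (F i) (V i)) ->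
  isIntRd d (fun x => sumn n (fun i => F i x)) (sumn n V).
Proof.
  induction n as [|n IH]; intros H; simpl; [apply isIntRd_0|].
  apply isIntRd_plus; [apply IH; intros; apply H; lia|apply H; lia].
Qed.

Lemma isIntRd_le d f g u v : isIntRd d f u -> isIntRd d g v -> (forall x, f x <= g x) ->
  u <= v.
Proof.
  intros [Hf Hu] [Hg Hv] H.
  apply (is_lim_seq_le _ _ u v (fun N => cubeInt_le (INR N) d f g (pos_INR N) Hf Hg H) Hu Hv).
Qed.

(** The cube integrals of f increase with N and stay below v, so they converge. *)
Lemma isIntRd_dominated d f g v : cubeContinuous d f -> (forall x, 0 <= f x <= g x) ->
  isIntRd d g v -> exists u, isIntRd d f u.
Proof.
  intros Hf H [Hg Hv].
  destruct (ex_finite_lim_seq_incr (fun N => cubeInt (INR N) d f) v) as [u Hu].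
  - intros N. apply cubeInt_incr; [|assumption|apply H].
    split; [apply pos_INR|apply le_INR; lia].
  - intros N. apply Rle_trans with (cubeInt (INR N) d g).
    + apply cubeInt_le; auto using pos_INR. apply H.
    + apply (is_lim_seq_incr_compare (fun N => cubeInt (INR N) d g)); [exact Hv|].
      intros M. apply cubeInt_incr; [|assumption|intros x; destruct (H x); lra].
      split; [apply pos_INR|apply le_INR; lia].
  - exists u. split; assumption.
Qed.

(** * The Gaussian integral *)

Lemma exp_monotone x y : x <= y -> exp x <= exp y.
Proof. intros [H| ->]; [apply Rlt_le, exp_increasing, H|apply Rle_refl]. Qed.

Definition bell (t : R) : R := exp (- t ^ 2 / 2).

Lemma continuous_bell t : continuous bell t.
Proof. apply (@ex_derive_continuous R_AbsRing R_NormedModule). unfold bell. auto_derive. exact I. Qed.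

Lemma ex_RInt_bell a b : ex_RInt bell a b.
Proof. apply (@ex_RInt_continuous R_CompleteNormedModule). intros. apply continuous_bell. Qed.

Definition bellPrim (y : R) : R := RInt bell 0 y.

Lemma is_derive_bellPrim y : is_derive bellPrim y (bell y).
Proof.
  apply (is_derive_RInt bell bellPrim 0 y); [|apply continuous_bell].
  exists (mkposreal 1 Rlt_0_1). intros z _. apply (@RInt_correct R_CompleteNormedModule), ex_RInt_bell.
Qed.

(* Chosen so that bellPrim^2 + 2 * bellComp is constant; its value is 2 * (PI / 4) at 0. *)
Definition bellKernel (y x : R) : R := exp (- y ^ 2 * (1 + x ^ 2) / 2) / (1 + x ^ 2).
Definition bellComp (y : R) : R := RInt (bellKernel y) 0 1.

Lemma is_derive_bellKernel y x :
  is_derive (fun u => bellKernel u x) y (- y * exp (- y ^ 2 * (1 + x ^ 2) / 2)).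
Proof.
  unfold bellKernel. assert (0 <= x ^ 2) by apply pow2_ge_0.
  auto_derive; [nra|].
  replace (- y ^ 2 * (1 + x ^ 2) / 2) with (- (y * (y * 1)) * (1 + x * (x * 1)) * / 2)
    by (unfold Rdiv; ring).
  field. nra.
Qed.

Lemma ex_RInt_bellKernel y : ex_RInt (bellKernel y) 0 1.
Proof.
  apply (@ex_RInt_continuous R_CompleteNormedModule). intros x _.
  apply (@ex_derive_continuous R_AbsRing R_NormedModule). unfold bellKernel.
  assert (0 <= x ^ 2) by apply pow2_ge_0. auto_derive. nra.
Qed.

Lemma is_derive_bellComp y :
  is_derive bellComp y (RInt (fun x => - y * exp (- y ^ 2 * (1 + x ^ 2) / 2)) 0 1).
Proof.
  rewrite (RInt_ext (fun x => - y * exp (- y ^ 2 * (1 + x ^ 2) / 2))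
                    (fun x => Derive (fun u => bellKernel u x) y)).
  2:{ intros x _. symmetry. apply is_derive_unique, is_derive_bellKernel. }
  apply (is_derive_RInt_param bellKernel 0 1 y).
  - exists (mkposreal 1 Rlt_0_1). intros z _ t _. eexists. apply is_derive_bellKernel.
  - intros t _.
    apply continuity_2d_pt_ext with (fun u v => - u * exp (- u ^ 2 * (1 + v ^ 2) / 2)).
    { intros u v. symmetry. apply is_derive_unique, is_derive_bellKernel. }
    apply continuity_2d_pt_mult.
    + apply continuity_2d_pt_opp, continuity_2d_pt_id1.
    + apply (continuity_1d_2d_pt_comp exp).
      * apply derivable_continuous_pt, derivable_pt_exp.
      * apply continuity_2d_pt_mult; [|apply continuity_2d_pt_const].
        apply continuity_2d_pt_mult.
        -- apply continuity_2d_pt_opp.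
           apply (continuity_2d_pt_ext (fun u v => u * u)); [intros; ring|].
           apply continuity_2d_pt_mult; apply continuity_2d_pt_id1.
        -- apply continuity_2d_pt_plus; [apply continuity_2d_pt_const|].
           apply (continuity_2d_pt_ext (fun u v => v * v)); [intros; ring|].
           apply continuity_2d_pt_mult; apply continuity_2d_pt_id2.
  - exists (mkposreal 1 Rlt_0_1). intros z _. apply ex_RInt_bellKernel.
Qed.

(** The substitution of y x for x turns the integral into [bellPrim y]. Twice this derivative
    cancels the derivative of [bellPrim y ^ 2]. *)
Lemma bellComp_derivative y :
  RInt (fun x => - y * exp (- y ^ 2 * (1 + x ^ 2) / 2)) 0 1 = - bell y * bellPrim y.
Proof.
  unfold bellPrim.
  replace (RInt bell 0 y) with (RInt bell (y * 0 + 0) (y * 1 + 0)) by (f_equal; ring).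
  rewrite <- (RInt_comp_lin bell y 0 0 1) by apply ex_RInt_bell.
  change (- bell y * ?u) with (scal (- bell y) u).
  rewrite <- (RInt_scal (V := R_CompleteNormedModule)).
  - apply RInt_ext. intros x _.
    change (- y * exp (- y ^ 2 * (1 + x ^ 2) / 2) = - bell y * (y * bell (y * x + 0))).
    unfold bell.
    replace (- y ^ 2 * (1 + x ^ 2) / 2) with (- y ^ 2 / 2 + - (y * x + 0) ^ 2 / 2) by field.
    rewrite exp_plus. ring.
  - apply (@ex_RInt_comp_lin R_NormedModule). apply ex_RInt_bell.
Qed.

Lemma bellPrim_bellComp y : bellPrim y ^ 2 + 2 * bellComp y = PI / 2.
Proof.
  set (h := fun y => bellPrim y ^ 2 + 2 * bellComp y).
  assert (Hd : forall t, is_derive h t 0).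
  { intros t. unfold h.
    evar_last.
    - apply (@is_derive_plus R_AbsRing R_NormedModule).
      + apply is_derive_pow, is_derive_bellPrim.
      + apply is_derive_scal, is_derive_bellComp.
    - rewrite bellComp_derivative. unfold plus; simpl. ring. }
  assert (H0 : h 0 = PI / 2).
  { unfold h, bellPrim, bellComp. rewrite RInt_point. unfold zero; simpl.
    rewrite (RInt_ext _ (fun x => / (1 + x ^ 2))).
    - rewrite (is_RInt_unique _ 0 1 (PI / 4)); [field|].
      replace (PI / 4) with (minus (atan 1) (atan 0)).
      + apply (is_RInt_derive atan).
        * intros x _. apply is_derive_Reals, derivable_pt_lim_atan.
        * intros x _. apply (@ex_derive_continuous R_AbsRing R_NormedModule).
          assert (0 <= x ^ 2) by apply pow2_ge_0. auto_derive. nra.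
      + rewrite atan_1, atan_0. change (PI / 4 + - 0 = PI / 4). ring.
    - intros x _. unfold bellKernel.
      replace (- 0 ^ 2 * (1 + x ^ 2) / 2) with 0 by field. rewrite exp_0.
      apply Rmult_1_l. }
  destruct (Req_dec y 0) as [->|Hy]; [exact H0|]. rewrite <- H0. fold (h y).
  destruct (MVT_gen h 0 y (fun _ => 0)) as [c [_ Hc]].
  - intros; apply Hd.
  - intros x _. apply continuity_pt_filterlim.
    apply (@ex_derive_continuous R_AbsRing R_NormedModule). exists 0. apply Hd.
  - lra.
Qed.

Lemma bellPrim_nonneg y : 0 <= y -> 0 <= bellPrim y.
Proof.
  intros Hy. apply RInt_ge_0; [assumption|apply ex_RInt_bell|].
  intros. apply Rlt_le, exp_pos.
Qed.

(** The kernel is at most [bell y] since 1 + x^2 >= 1. Hence [bellComp] tends to 0, which leaves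
    [bellPrim ^ 2] tending to PI / 2. *)
Lemma bellComp_bounds y : 0 <= bellComp y <= bell y.
Proof.
  split.
  - apply RInt_ge_0; [lra|apply ex_RInt_bellKernel|]. intros x _. unfold bellKernel.
    assert (0 <= x ^ 2) by apply pow2_ge_0.
    apply Rlt_le, Rdiv_lt_0_compat; [apply exp_pos|lra].
  - replace (bell y) with (RInt (fun _ : R => bell y) 0 1).
    + apply RInt_le; [lra|apply ex_RInt_bellKernel|apply ex_RInt_const|].
      intros x _. unfold bellKernel, bell. assert (0 <= x ^ 2) by apply pow2_ge_0.
      assert (0 <= y ^ 2 * x ^ 2) by (apply Rmult_le_pos; apply pow2_ge_0).
      apply Rle_trans with (exp (- y ^ 2 * (1 + x ^ 2) / 2)).
      * rewrite <- (Rmult_1_r (exp _)) at 2. apply Rmult_le_compat_l.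
        -- apply Rlt_le, exp_pos.
        -- rewrite <- Rinv_1. apply Rinv_le_contravar; lra.
      * apply exp_monotone. nra.
    + rewrite RInt_const. unfold scal; simpl; unfold mult; simpl. ring.
Qed.

Lemma bellPrim_opp y : bellPrim (- y) = - bellPrim y.
Proof.
  unfold bellPrim.
  replace (RInt bell 0 (- y)) with (RInt bell (-1 * 0 + 0) (-1 * y + 0)) by (f_equal; ring).
  rewrite <- (RInt_comp_lin bell (-1) 0 0 y) by apply ex_RInt_bell.
  rewrite (RInt_scal (V := R_CompleteNormedModule)).
  - unfold scal at 1; simpl; unfold mult; simpl.
    rewrite (RInt_ext _ bell).
    + ring.
    + intros x _. unfold bell. f_equal. field.
  - apply (ex_RInt_ext bell); [|apply ex_RInt_bell]. intros x _. unfold bell. f_equal. field.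
Qed.

Lemma is_lim_seq_bell (m : R) : is_lim_seq (fun N => bell (INR N + m)) 0.
Proof.
  (* The majorant works because u^2 / 2 >= u - 1 for every u. *)
  apply is_lim_seq_le_le_loc with (fun _ => 0) (fun N => exp (1 - (INR N + m))).
  - exists 0%nat. intros N _. split; [apply Rlt_le, exp_pos|].
    apply exp_monotone. set (u := INR N + m). nra.
  - apply is_lim_seq_const.
  - apply (is_lim_comp_seq exp (fun N => 1 - (INR N + m)) m_infty 0).
    + apply is_lim_exp_m.
    + exists 0%nat. intros; discriminate.
    + replace m_infty with (Rbar_opp p_infty) by reflexivity.
      apply (is_lim_seq_ext (fun N => - (INR N + (m - 1)))); [intros; ring|].
      apply -> (is_lim_seq_opp (fun N => INR N + (m - 1)) p_infty).
      eapply is_lim_seq_plus; [apply is_lim_seq_INR|apply is_lim_seq_const|reflexivity].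
Qed.

Lemma is_lim_seq_bellPrim (m : R) :
  is_lim_seq (fun N => bellPrim (INR N + m)) (sqrt (PI / 2)).
Proof.
  assert (H0 : is_lim_seq (fun N => bellComp (INR N + m)) 0).
  { apply is_lim_seq_le_le with (fun _ => 0) (fun N => bell (INR N + m)).
    - intros N. apply bellComp_bounds.
    - apply is_lim_seq_const.
    - apply is_lim_seq_bell. }
  assert (H1 : is_lim_seq (fun N => sqrt (PI / 2 - 2 * bellComp (INR N + m))) (sqrt (PI / 2))).
  { apply (is_lim_seq_continuous sqrt).
    - apply continuity_pt_sqrt. pose proof PI_RGT_0. lra.
    - replace (Finite (PI / 2)) with (Finite (PI / 2 - 2 * 0)) by (f_equal; ring).
      apply is_lim_seq_minus'; [apply is_lim_seq_const|].
      apply (is_lim_seq_scal_l _ 2 0 H0). }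
  eapply is_lim_seq_ext_loc; [|exact H1].
  (* The square root of [bellPrim ^ 2] gives back [bellPrim] at nonnegative arguments, which is the
     case for large N. *)
  destruct (INR_unbounded (- m)) as [N0 HN0].
  exists N0. intros N HN. rewrite <- (bellPrim_bellComp (INR N + m)).
  replace (bellPrim (INR N + m) ^ 2 + 2 * bellComp (INR N + m) - 2 * bellComp (INR N + m))
    with (bellPrim (INR N + m) ^ 2) by ring.
  apply sqrt_pow2, bellPrim_nonneg. apply le_INR in HN. lra.
Qed.

Definition gauss1 (t m : R) : R := / sqrt (2 * PI) * exp (- ((t - m) * (t - m)) / 2).

Lemma continuous_gauss1 m t : continuous (fun t => gauss1 t m) t.
Proof.
  apply (@ex_derive_continuous R_AbsRing R_NormedModule). unfold gauss1. auto_derive. exact I.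
Qed.

Lemma RInt_gauss1 (N m : R) :
  RInt (fun t => gauss1 t m) (- N) N
  = / sqrt (2 * PI) * (bellPrim (N + - m) + bellPrim (N + m)).
Proof.
  assert (E : RInt (fun t => bell (t - m)) (- N) N = bellPrim (N + - m) + bellPrim (N + m)).
  { transitivity (RInt (fun t => 1 * bell (1 * t + - m)) (- N) N).
    2: { transitivity (RInt bell (1 * - N + - m) (1 * N + - m)).
      { apply (RInt_comp_lin (V := R_CompleteNormedModule)), ex_RInt_bell. }
      rewrite <- (RInt_Chasles bell _ 0) by apply ex_RInt_bell.
      rewrite <- (opp_RInt_swap bell 0 _) by apply ex_RInt_bell.
      fold (bellPrim (1 * - N + - m)). fold (bellPrim (1 * N + - m)).
      replace (1 * - N + - m) with (- (N + m)) by ring. rewrite bellPrim_opp.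
      replace (1 * N + - m) with (N + - m) by ring.
      change (- - bellPrim (N + m) + bellPrim (N + - m)
              = bellPrim (N + - m) + bellPrim (N + m)). ring. }
    apply RInt_ext. intros t _. change (bell (t - m) = 1 * bell (1 * t + - m)).
      rewrite Rmult_1_l. f_equal. ring. }
  rewrite <- E, (RInt_ext _ (fun t => scal (/ sqrt (2 * PI)) (bell (t - m)))).
  - rewrite (RInt_scal (V := R_CompleteNormedModule)); [reflexivity|].
    apply (@ex_RInt_continuous R_CompleteNormedModule). intros t _.
    apply (@ex_derive_continuous R_AbsRing R_NormedModule). unfold bell. auto_derive. exact I.
  - intros t _. unfold gauss1, bell.
    change (/ sqrt (2 * PI) * exp (- ((t - m) * (t - m)) / 2)
            = / sqrt (2 * PI) * exp (- (t - m) ^ 2 / 2)).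
    f_equal. f_equal. field.
Qed.

Lemma is_lim_seq_gauss1 (m : R) :
  is_lim_seq (fun N => RInt (fun t => gauss1 t m) (- INR N) (INR N)) 1.
Proof.
  pose proof PI_RGT_0 as HP.
  apply (is_lim_seq_ext
    (fun N => / sqrt (2 * PI) * (bellPrim (INR N + - m) + bellPrim (INR N + m)))).
  { intros N. symmetry. apply RInt_gauss1. }
  replace (Finite 1)
    with (Rbar_mult (/ sqrt (2 * PI)) (Finite (sqrt (PI / 2) + sqrt (PI / 2)))).
  - apply is_lim_seq_scal_l, is_lim_seq_plus'; apply is_lim_seq_bellPrim.
  - simpl. f_equal.
    replace (2 * PI) with (2 ^ 2 * (PI / 2)) by field.
    rewrite sqrt_mult, sqrt_pow2 by lra.
    assert (0 < sqrt (PI / 2)) by (apply sqrt_lt_R0; lra). field. lra.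
Qed.

(** * Gaussian densities on R^d *)

Lemma gauss_pos d x m : 0 < gauss d x m.
Proof.
  unfold gauss. pose proof PI_RGT_0.
  apply Rmult_lt_0_compat; [|apply exp_pos].
  apply Rinv_0_lt_compat, pow_lt, sqrt_lt_R0. lra.
Qed.

Lemma gauss_upd d x t m : gauss (S d) (upd x d t) m = gauss1 t (m d) * gauss d x m.
Proof.
  unfold gauss, gauss1, sqnorm. simpl sumn. rewrite upd_eq.
  rewrite (sumn_ext d (fun j => (upd x d t j - m j) * (upd x d t j - m j))
                      (fun j => (x j - m j) * (x j - m j)))
    by (intros; rewrite upd_neq by lia; reflexivity).
  set (S0 := sumn d _). simpl pow. rewrite Rinv_mult.
  replace (- (S0 + (t - m d) * (t - m d)) / 2)
    with (- ((t - m d) * (t - m d)) / 2 + - S0 / 2) by field.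
  rewrite exp_plus. ring.
Qed.

Lemma cubeContinuous_gauss d m : cubeContinuous d (fun x => gauss d x m).
Proof.
  unfold gauss, sqnorm. apply cubeContinuous_scal.
  apply (cubeContinuous_comp_continuous d (fun s => exp (- s / 2))).
  - apply cubeContinuous_sumn. intros i Hi.
    assert (cubeContinuous d (fun x => x i - m i)).
    { apply cubeContinuous_minus; [now apply cubeContinuous_coord|apply cubeContinuous_const]. }
    now apply cubeContinuous_mult.
  - intros s. apply derivable_continuous_pt. reg.
Qed.

Lemma isIntRd_gauss d m : isIntRd d (fun x => gauss d x m) 1.
Proof.
  induction d as [|d [_ IH]]; (split; [apply cubeContinuous_gauss|]).
  - apply (is_lim_seq_ext (fun _ => 1)); [|apply is_lim_seq_const].
    intros N. unfold cubeInt, gauss, sqnorm. simpl.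
    replace (- 0 / 2) with 0 by field. rewrite exp_0. field.
  (* The last coordinate factors out of the density, so the cube integral is a one-dimensional
     Gaussian integral times the cube integral in dimension d. *)
  - eapply is_lim_seq_ext; [|
      replace (Finite 1) with (Finite (1 * 1)) by (f_equal; ring);
      apply (is_lim_seq_mult' _ _ _ _ (is_lim_seq_gauss1 (m d)) IH)].
    intros N. simpl. rewrite Rmult_comm.
    set (c := cubeInt (INR N) d (fun x => gauss d x m)).
    rewrite (RInt_ext (fun t => cubeInt _ _ _) (fun t => scal c (gauss1 t (m d)))).
    + rewrite (RInt_scal (V := R_CompleteNormedModule)); [reflexivity|].
      apply (@ex_RInt_continuous R_CompleteNormedModule). intros; apply continuous_gauss1.
    + intros t _. rewrite (cubeInt_ext _ _ _ (fun x => gauss1 t (m d) * gauss d x m))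
        by (intros; apply gauss_upd).
      rewrite cubeInt_scal; [|apply pos_INR|apply cubeContinuous_gauss].
      apply Rmult_comm.
Qed.

Lemma isIntRd_scal_gauss d c m : isIntRd d (fun x => c * gauss d x m) c.
Proof.
  pose proof (isIntRd_scal d c _ 1 (isIntRd_gauss d m)) as H.
  rewrite Rmult_1_r in H. exact H.
Qed.

Lemma isIntRd_mixDens n d nu X : isIntRd d (fun x => mixDens n d nu X x) (sumn n nu).
Proof. apply isIntRd_sumn. intros. apply isIntRd_scal_gauss. Qed.

(** Completing the square: with equal covariances the quotient is again a Gaussian, centred at a + b
    - c, up to a factor free of x. *)
Lemma gauss_mult_div d x a b c :
  gauss d x a * gauss d x b / gauss d x c
  = exp (dot d (fun j => a j - c j) (fun j => b j - c j))
    * gauss d x (fun j => a j + b j - c j).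
Proof.
  unfold gauss. pose proof PI_RGT_0.
  assert (E : dot d (fun j => a j - c j) (fun j => b j - c j)
    = - sqnorm d (fun j => x j - a j) / 2 + - sqnorm d (fun j => x j - b j) / 2
      + - (- sqnorm d (fun j => x j - c j) / 2)
      + - (- sqnorm d (fun j => x j - (a j + b j - c j)) / 2)).
  { unfold dot, sqnorm. induction d as [|d IH]; simpl; lra. }
  rewrite E, !exp_plus, !exp_Ropp.
  assert (Hk : (sqrt (2 * PI)) ^ d <> 0)
    by (apply pow_nonzero, Rgt_not_eq, sqrt_lt_R0; lra).
  field. repeat split; try assumption; apply Rgt_not_eq, exp_pos.
Qed.

(** After the square is expanded, [gauss_mult_div] makes each pair a multiple of a Gaussian of mass
    1. *)
Lemma isIntRd_chi2_form n d nu X c :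
  isIntRd d (fun x => mixDens n d nu X x ^ 2 / gauss d x c) (expForm n d X nu c).
Proof.
  eapply isIntRd_ext; [|apply isIntRd_sumn; intros i _; apply isIntRd_sumn; intros j _;
    apply (isIntRd_scal_gauss d _ (fun a => X i a + X j a - c a))].
  intros x. cbv beta. unfold mixDens. simpl. rewrite Rmult_1_r, sumn_mult.
  unfold Rdiv. rewrite Rmult_comm, <- sumn_scal. apply sumn_ext; intros i _.
  rewrite <- sumn_scal. apply sumn_ext; intros j _. rewrite Rmult_assoc.
  unfold shiftLetter. rewrite <- gauss_mult_div. unfold Rdiv. ring.
Qed.

(** Two uses of [gauss_mult_div] leave the exponent <X_i, X_j> + <X_i + X_j, m>, which equals <X_i +
    m, X_j + m> - |m|^2; hence the centre -m and the factor exp(-|m|^2). *)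
Lemma isIntRd_gauss_likelihood_sqr n d nu X m :
  isIntRd d (fun x => gauss d x m * (mixDens n d nu X x / gauss d x (fun _ => 0)) ^ 2)
    (exp (- sqnorm d m) * expForm n d X nu (fun j => - m j)).
Proof.
  eapply isIntRd_ext; [|unfold expForm; rewrite <- sumn_scal;
    apply isIntRd_sumn; intros i _; rewrite <- sumn_scal; apply isIntRd_sumn; intros j _;
    apply (isIntRd_scal_gauss d _ (fun a => (X i a + X j a - 0) + m a - 0))].
  intros x. cbv beta. unfold mixDens.
  set (g0 := gauss d x (fun _ => 0)).
  replace (gauss d x m * (sumn n (fun i => nu i * gauss d x (X i)) / g0) ^ 2)
    with ((gauss d x m * / g0 * / g0) *
          (sumn n (fun i => nu i * gauss d x (X i)) * sumn n (fun i => nu i * gauss d x (X i))))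
    by (unfold Rdiv; ring).
  rewrite sumn_mult, <- sumn_scal. apply sumn_ext; intros i _.
  rewrite <- sumn_scal. apply sumn_ext; intros j _.
  pose proof (gauss_mult_div d x (X i) (X j) (fun _ => 0)) as E1.
  pose proof (gauss_mult_div d x (fun a => X i a + X j a - 0) m (fun _ => 0)) as E2.
  cbv beta in E1, E2. fold g0 in E1, E2.
  transitivity (nu i * nu j * (gauss d x (X i) * gauss d x (X j) / g0 * gauss d x m / g0));
    [|unfold Rdiv; ring].
  rewrite E1.
  transitivity (nu i * nu j * (exp (dot d (fun a => X i a - 0) (fun a => X j a - 0)) *
    (gauss d x (fun a => X i a + X j a - 0) * gauss d x m / g0))); [|unfold Rdiv; ring].
  rewrite E2.
  replace (exp (- sqnorm d m) * (nu i * nu j * exp (dot d (shiftLetter X (fun j => - m j) i)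
             (shiftLetter X (fun j => - m j) j))))
    with (nu i * nu j * (exp (- sqnorm d m) * exp (dot d (shiftLetter X (fun j => - m j) i)
             (shiftLetter X (fun j => - m j) j)))) by ring.
  rewrite <- exp_plus.
  replace (- sqnorm d m + dot d (shiftLetter X (fun j => - m j) i)
             (shiftLetter X (fun j => - m j) j))
    with (dot d (fun a => X i a - 0) (fun a => X j a - 0)
          + dot d (fun a => X i a + X j a - 0 - 0) (fun a => m a - 0)).
  - rewrite exp_plus. ring.
  - clear. unfold dot, sqnorm, shiftLetter. induction d as [|d IH]; simpl; [ring|lra].
Qed.

(** * Positivity of mixture densities and averaging of reciprocals *)

Lemma sqnorm_inCube d M x : inCube d M x -> sqnorm d x <= INR d * M ^ 2.
Proof.
  unfold sqnorm. induction d as [|d IH]; intros Hx; [simpl; lra|].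
  change (sumn d (fun j => x j * x j) + x d * x d <= INR (S d) * M ^ 2). rewrite S_INR.
  assert (x d * x d <= M ^ 2).
  { specialize (Hx d (Nat.lt_succ_diag_r d)). apply Rabs_le_between in Hx. nra. }
  assert (sumn d (fun j => x j * x j) <= INR d * M ^ 2); [|lra].
  apply IH. intros j Hj. apply Hx; lia.
Qed.

Lemma katomic_sqnorm_le k d Rr w mu i : katomic k d Rr w mu -> (i < k)%nat ->
  sqnorm d (mu i) <= Rr ^ 2.
Proof.
  intros [_ [_ H]] Hi. specialize (H i Hi).
  rewrite <- (sqrt_sqrt (sqnorm d (mu i))) by apply sqnorm_nonneg.
  pose proof (sqrt_pos (sqnorm d (mu i))). nra.
Qed.

(** On the cube every atom lies within [s + Rr] of x, so each component is at least [a], and the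
    weights sum to 1. *)
Lemma cubePositive_mixDens k d Rr w mu : 0 < Rr -> katomic k d Rr w mu ->
  cubePositive d (fun x => mixDens k d w mu x).
Proof.
  intros HR Hk M. pose proof PI_RGT_0. pose proof Hk as [Hw [Hs _]].
  set (s := sqrt (INR d * M ^ 2)).
  set (a := / sqrt (2 * PI) ^ d * exp (- (s + Rr) ^ 2 / 2)).
  exists a. split.
  { apply Rmult_lt_0_compat; [|apply exp_pos].
    apply Rinv_0_lt_compat, pow_lt, sqrt_lt_R0. lra. }
  intros x Hx. rewrite <- (Rmult_1_r a), <- Hs, <- sumn_scal. unfold mixDens.
  apply sumn_le. intros i Hi. rewrite Rmult_comm.
  apply Rmult_le_compat_l; [auto|]. unfold gauss, a.
  apply Rmult_le_compat_l.
  { apply Rlt_le, Rinv_0_lt_compat, pow_lt, sqrt_lt_R0. lra. }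
  apply exp_monotone.
  enough (sqnorm d (fun j => x j - mu i j) <= (s + Rr) ^ 2) by lra.
  apply sqnorm_sub; [apply sqrt_pos|lra| |].
  - unfold s. rewrite pow2_sqrt by (apply Rmult_le_pos; [apply pos_INR|apply pow2_ge_0]).
    now apply sqnorm_inCube.
  - now apply (katomic_sqnorm_le k d Rr w).
Qed.

Lemma cubeContinuous_mixDens n d nu X : cubeContinuous d (fun x => mixDens n d nu X x).
Proof. apply isIntRd_mixDens. Qed.

Lemma mixDens_pos k d Rr w mu x : 0 < Rr -> katomic k d Rr w mu -> 0 < mixDens k d w mu x.
Proof.
  intros HR Hk.
  (* Every point lies in the cube whose half-width is the sum of the absolute values of its
     coordinates. *)
  destruct (cubePositive_mixDens k d Rr w mu HR Hk (sumn d (fun j => Rabs (x j))))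
    as [a [Ha H]].
  apply Rlt_le_trans with a; [exact Ha|]. apply H.
  clear. intros j Hj. induction d as [|d IH]; [lia|]. simpl.
  assert (0 <= sumn d (fun j => Rabs (x j))) by (apply sumn_nonneg; intros; apply Rabs_pos).
  pose proof (Rabs_pos (x d)).
  destruct (Nat.eq_dec j d) as [->|Hn]; [lra|]. specialize (IH ltac:(lia)). lra.
Qed.

(** Jensen for 1/t, by averaging the tangent at the mean q: 1/a >= 2/q - a/q^2. *)
Lemma inv_mean_le k w a : (forall i, (i < k)%nat -> 0 <= w i) -> sumn k w = 1 ->
  (forall i, 0 < a i) -> 0 < sumn k (fun i => w i * a i) ->
  / sumn k (fun i => w i * a i) <= sumn k (fun i => w i / a i).
Proof.
  intros Hw Hs Ha Hq. set (q := sumn k (fun i => w i * a i)) in *.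
  assert (Hiq : 0 < / q) by now apply Rinv_0_lt_compat.
  replace (/ q) with (sumn k (fun i => 2 * / q * w i + - (/ q) ^ 2 * (w i * a i))).
  - apply sumn_le. intros i Hi.
    replace (2 * / q * w i + - (/ q) ^ 2 * (w i * a i))
      with (w i * (2 * / q + - (/ q) ^ 2 * a i)) by ring.
    unfold Rdiv. apply Rmult_le_compat_l; [auto|].
    specialize (Ha i). pose proof (Rinv_0_lt_compat _ Ha).
    enough (0 <= a i * (/ a i - / q) ^ 2).
    { replace (a i * (/ a i - / q) ^ 2)
        with (/ a i - 2 * / q + (/ q) ^ 2 * a i) in H0 by (field; lra). lra. }
    apply Rmult_le_pos; [lra|apply pow2_ge_0].
  - rewrite sumn_plus, !sumn_scal, Hs. fold q. field. lra.
Qed.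

(** * Comparison of the divergences *)

(* The KL integrand may be negative; adding q - p keeps its integral, p and q having mass 1. *)
Definition divNonneg (D : Div) (p q : R) : R :=
  match D with KLdiv => p * ln (p / q) - p + q | _ => divIntegrand D p q end.

Lemma ln_le_sub x : 0 < x -> ln x <= x - 1.
Proof.
  intros Hx. pose proof (exp_ineq1_le (ln x)) as H. rewrite exp_ln in H by assumption. lra.
Qed.

(** For KL, with s and r the square roots of p and q, ln(p/q) = -2 ln(r/s) >= 2 (1 - r/s), which
    yields exactly (s - r)^2. The chi-square integrand dominates the KL one because ln(p/q) <= p/q -
    1. *)
Lemma divNonneg_ge_hellinger D p q : 0 < p -> 0 < q -> (sqrt p - sqrt q) ^ 2 <= divNonneg D p q.
Proof.
  intros Hp Hq.
  assert (HKL : (sqrt p - sqrt q) ^ 2 <= divNonneg KLdiv p q).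
  { simpl divNonneg. rewrite <- (sqrt_sqrt p), <- (sqrt_sqrt q) by lra.
    pose proof (sqrt_lt_R0 p Hp). pose proof (sqrt_lt_R0 q Hq).
    rewrite !sqrt_square by lra. set (s := sqrt p) in *. set (r := sqrt q) in *.
    replace (s * s / (r * r)) with (/ (r / s) * / (r / s)) by (field; lra).
    assert (0 < r / s) by (apply Rdiv_lt_0_compat; lra).
    rewrite ln_mult, !ln_Rinv by (try apply Rinv_0_lt_compat; assumption).
    pose proof (ln_le_sub (r / s) H1).
    assert (s * s * ln (r / s) <= s * s * (r / s - 1)) by (apply Rmult_le_compat_l; nra).
    replace (s * s * (r / s - 1)) with (s * r - s * s) in H3 by (field; lra). nra. }
  destruct D.
  - apply Rle_refl.
  - exact HKL.
  - eapply Rle_trans; [exact HKL|]. simpl.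
    assert (0 < p / q) by (apply Rdiv_lt_0_compat; lra).
    pose proof (ln_le_sub (p / q) H).
    replace ((p - q) * ((p - q) * 1) / q) with (p * (p / q - 1) - p + q) by (field; lra).
    nra.
Qed.

Lemma divNonneg_le_chi2 D p q : 0 < p -> 0 < q -> divNonneg D p q <= (p - q) ^ 2 / q.
Proof.
  intros Hp Hq. destruct D.
  - apply (divNonneg_ge_hellinger Chi2 p q Hp Hq).
  - simpl.
    assert (0 < p / q) by (apply Rdiv_lt_0_compat; lra).
    pose proof (ln_le_sub (p / q) H).
    replace ((p - q) * ((p - q) * 1) / q) with (p * (p / q - 1) - p + q) by (field; lra).
    nra.
  - apply Rle_refl.
Qed.

(* By AM-GM, (p - q)^2 / (2 (p + q)) lies between the two sides. *)
Lemma hellinger_ge_test tau g p q : 0 < p -> 0 < q ->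
  2 * tau * ((p - q) * g) + - 2 * tau ^ 2 * (p * g ^ 2 + q * g ^ 2) <= (sqrt p - sqrt q) ^ 2.
Proof.
  intros Hp Hq.
  pose proof (sqrt_lt_R0 p Hp). pose proof (sqrt_lt_R0 q Hq).
  assert (E1 : p = sqrt p ^ 2) by (rewrite pow2_sqrt; lra).
  assert (E2 : q = sqrt q ^ 2) by (rewrite pow2_sqrt; lra).
  set (s := sqrt p) in *. set (r := sqrt q) in *. rewrite E1, E2.
  (* With t = [tau * g], this square gives (s - r)^2 >= 2 t (p - q) - t^2 (s + r)^2, and (s + r)^2 =
     2 (p + q) - (s - r)^2. *)
  assert (0 <= (s - r - 2 * (tau * g * (s + r)) / 2) ^ 2) by apply pow2_ge_0.
  assert (0 <= (tau * g) ^ 2 * (s - r) ^ 2) by (apply Rmult_le_pos; apply pow2_ge_0).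
  nra.
Qed.

Lemma cubeContinuous_divNonneg D d p q :
  cubeContinuous d p -> cubeContinuous d q -> cubePositive d p -> cubePositive d q ->
  (forall x, 0 < p x) -> (forall x, 0 < q x) ->
  cubeContinuous d (fun x => divNonneg D (p x) (q x)).
Proof.
  intros Cp Cq Pp Pq Hp Hq.
  assert (Cln : forall y, 0 < y -> continuity_pt ln y).
  { intros y Hy. apply derivable_continuous_pt. exists (/ y). now apply derivable_pt_lim_ln. }
  destruct D; simpl.
  - apply cubeContinuous_sqr, cubeContinuous_minus; apply cubeContinuous_comp_pos; auto;
      intros; apply continuity_pt_sqrt; lra.
  - apply (cubeContinuous_ext d (fun x => p x * (ln (p x) - ln (q x)) - p x + q x)).
    { intros x. unfold Rdiv. rewrite ln_mult, ln_Rinv; auto.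
      now apply Rinv_0_lt_compat. }
    apply cubeContinuous_plus; [|assumption]. apply cubeContinuous_minus; [|assumption].
    apply cubeContinuous_mult; [assumption|].
    apply cubeContinuous_minus; apply cubeContinuous_comp_pos; auto.
  - apply (cubeContinuous_mult d (fun x => (p x - q x) ^ 2) (fun x => / q x)).
    + now apply cubeContinuous_sqr, cubeContinuous_minus.
    + apply (cubeContinuous_comp_pos d Rinv); auto. intros y Hy.
      apply continuity_pt_inv; [apply derivable_continuous_pt, derivable_pt_id|lra].
Qed.

(** * Joining the two mixtures *)

Definition joinAtoms (k : nat) (mu mu' : nat -> nat -> R) (i : nat) : nat -> R :=
  if Nat.ltb i k then mu i else mu' (i - k)%nat.

Definition diffWeights (k : nat) (w w' : nat -> R) (i : nat) : R :=
  if Nat.ltb i k then w i else - w' (i - k)%nat.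

(** Taking F to be a Gaussian density or a tensor entry transfers densities and moments to the
    signed measure. *)
Lemma sumn_join k w w' mu mu' (F : (nat -> R) -> R) :
  sumn (k + k) (fun i => diffWeights k w w' i * F (joinAtoms k mu mu' i))
  = sumn k (fun i => w i * F (mu i)) - sumn k (fun i => w' i * F (mu' i)).
Proof.
  rewrite sumn_add. unfold Rminus, diffWeights, joinAtoms. f_equal.
  - apply sumn_ext. intros i Hi. apply Nat.ltb_lt in Hi. now rewrite Hi.
  - transitivity (-1 * sumn k (fun i => w' i * F (mu' i))); [|ring].
    rewrite <- sumn_scal. apply sumn_ext. intros i Hi.
    replace (Nat.ltb (k + i) k) with false by (symmetry; apply Nat.ltb_ge; lia).
    replace (k + i - k)%nat with i by lia. ring.
Qed.

(** This supplies the moment of order 0, which the maximum over orders from 1 leaves out. *)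
Lemma sumn_diffWeights k w w' : sumn k w = 1 -> sumn k w' = 1 ->
  sumn (k + k) (diffWeights k w w') = 0.
Proof.
  intros H H'. pose proof (sumn_join k w w' (fun _ _ => 0) (fun _ _ => 0) (fun _ => 1)) as E.
  cbv beta in E.
  rewrite (sumn_ext (k + k) (diffWeights k w w') (fun i => diffWeights k w w' i * 1))
    by (intros; ring).
  rewrite E, (sumn_ext k _ w), (sumn_ext k (fun i => w' i * 1) w') by (intros; ring). lra.
Qed.

Lemma mixDens_join k d w w' mu mu' x :
  mixDens (k + k) d (diffWeights k w w') (joinAtoms k mu mu') x
  = mixDens k d w mu x - mixDens k d w' mu' x.
Proof. apply (sumn_join k w w' mu mu' (gauss d x)). Qed.

Lemma momDiffSq_join k d l w w' mu mu' :
  momDiffSq k d l w w' mu mu'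
  = wordNormSq (k + k) d (repeat (joinAtoms k mu mu') l) (diffWeights k w w').
Proof.
  rewrite <- wordNormSq_repeat_tensor. unfold momDiffSq.
  f_equal. apply functional_extensionality. intros s.
  unfold momEntry. now rewrite <- sumn_join with (F := fun x => prodCoords x s).
Qed.

Lemma joinAtoms_sqnorm_le k d Rr w w' mu mu' i :
  katomic k d Rr w mu -> katomic k d Rr w' mu' -> (i < k + k)%nat ->
  sqnorm d (joinAtoms k mu mu' i) <= Rr ^ 2.
Proof.
  intros H H' Hi. unfold joinAtoms. destruct (Nat.ltb_spec i k).
  - now apply (katomic_sqnorm_le k d Rr w).
  - apply (katomic_sqnorm_le k d Rr w'); [assumption|lia].
Qed.

(** * Maxima over the orders and the explicit constant *)

Lemma maxUpTo_ge L g l : (1 <= l <= L)%nat -> g l <= maxUpTo L g.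
Proof.
  induction L as [|L IH]; intros Hl; [lia|].
  destruct L as [|L].
  - replace l with 1%nat by lia. apply Rle_refl.
  - change (g l <= Rmax (maxUpTo (S L) g) (g (S (S L)))).
    destruct (Nat.eq_dec l (S (S L))) as [->|]; [apply Rmax_r|].
    eapply Rle_trans; [apply IH; lia|apply Rmax_l].
Qed.

Lemma maxUpTo_attained L g : (1 <= L)%nat ->
  exists l, (1 <= l <= L)%nat /\ maxUpTo L g = g l.
Proof.
  induction L as [|L IH]; intros HL; [lia|].
  destruct L as [|L].
  - exists 1%nat. split; [lia|reflexivity].
  - change (maxUpTo (S (S L)) g) with (Rmax (maxUpTo (S L) g) (g (S (S L)))).
    destruct IH as [l [Hl E]]; [lia|].
    unfold Rmax. destruct (Rle_dec (maxUpTo (S L) g) (g (S (S L)))).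
    + exists (S (S L)). split; [lia|reflexivity].
    + exists l. split; [lia|exact E].
Qed.

Lemma fact_le_pow n b : INR n <= b -> INR (fact n) <= b ^ n.
Proof.
  revert b. induction n as [|n IH]; intros b Hb; [simpl; lra|].
  rewrite fact_simpl, mult_INR. simpl pow.
  apply Rmult_le_compat; [apply pos_INR|apply pos_INR|assumption|].
  apply IH. rewrite S_INR in Hb. lra.
Qed.

(** The left side is the reciprocal of the constant produced by the lower bound. It is absorbed
    using (2k - 1)! <= (2k)^(2k), 4 e <= (4 e)^(4k) and 8 e k = 4 e (2k). *)
Lemma const_inequality e k : 1 <= e -> (1 <= k)%nat ->
  4 * e * INR (fact (2 * k - 1)) ^ 2 <= (8 * e * INR k) ^ (4 * k).
Proof.
  intros He Hk. set (b := INR (2 * k)).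
  assert (Hb : 1 <= b) by (apply (le_INR 1); lia).
  assert (HF : INR (fact (2 * k - 1)) <= b ^ (2 * k)).
  { apply Rle_trans with (b ^ (2 * k - 1)).
    - apply fact_le_pow, le_INR. lia.
    - apply Rle_pow; [exact Hb|lia]. }
  assert (HF2 : INR (fact (2 * k - 1)) ^ 2 <= b ^ (4 * k)).
  { replace (4 * k)%nat with (2 * k * 2)%nat by lia. rewrite pow_mult.
    apply pow_incr. split; [apply pos_INR|exact HF]. }
  replace (8 * e * INR k) with (4 * e * b) by (unfold b; rewrite mult_INR; simpl; ring).
  rewrite Rpow_mult_distr. apply Rmult_le_compat; [lra|apply pow2_ge_0| |exact HF2].
  rewrite <- (pow_1 (4 * e)) at 1. apply Rle_pow; [lra|lia].
Qed.

(** * Both bounds for a given pair of mixtures *)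

Section MomentComparison.

Variables (Rr : R) (k d : nat) (w w' : nat -> R) (mu mu' : nat -> nat -> R).
Hypothesis Rr_gt0 : 0 < Rr.
Hypothesis k_ge1 : (1 <= k)%nat.
Hypothesis katomic_w : katomic k d Rr w mu.
Hypothesis katomic_w' : katomic k d Rr w' mu'.

Let m2 := maxUpTo (2 * k - 1) (fun l => momDiffSq k d l w w' mu mu').
Let X := joinAtoms k mu mu'.
Let nu := diffWeights k w w'.
Let e := exp ((1 + 3 * Rr) ^ 2).
Let p := mixDens k d w mu.
Let q := mixDens k d w' mu'.

Lemma maxMoment_nonneg : 0 <= m2.
Proof.
  destruct (maxUpTo_attained (2 * k - 1) (fun l => momDiffSq k d l w w' mu mu'))
    as [l [_ E]]; [lia|].
  unfold m2. rewrite E, momDiffSq_join. apply wordNormSq_nonneg.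
Qed.

Lemma expForm_le_maxMoment c : sqnorm d c <= Rr ^ 2 -> expForm (k + k) d X nu c <= e * m2.
Proof.
  intros Hc. rewrite <- (pow2_sqrt m2) by apply maxMoment_nonneg.
  apply expForm_le; try assumption; try lra.
  - apply sqrt_pos.
  - intros i Hi. now apply (joinAtoms_sqnorm_le k d Rr w w').
  (* There are 2k joined atoms, so the orders needed are 0, settled by the zero total mass, and 1 to
     2k - 1, covered by the maximum. *)
  - intros l Hl. rewrite pow2_sqrt by apply maxMoment_nonneg. destruct l as [|l].
    + simpl. unfold nu. rewrite sumn_diffWeights; [|apply katomic_w|apply katomic_w'].
      pose proof maxMoment_nonneg. lra.
    + unfold X, nu. rewrite <- momDiffSq_join.
      apply (maxUpTo_ge (2 * k - 1) (fun l => momDiffSq k d l w w' mu mu')). lia.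
Qed.

(** Only the series term at the maximizing order is kept; its factorial is at most (2k - 1)!. *)
Lemma expForm_ge_maxMoment :
  m2 / INR (fact (2 * k - 1)) <= expForm (k + k) d X nu (fun _ => 0).
Proof.
  destruct (maxUpTo_attained (2 * k - 1) (fun l => momDiffSq k d l w w' mu mu'))
    as [l [Hl E]]; [lia|].
  eapply Rle_trans; [|apply (expForm_ge _ _ _ _ _ l)].
  replace (shiftLetter X (fun _ => 0)) with X.
  - pose proof maxMoment_nonneg as H. unfold m2 in *. rewrite E, momDiffSq_join in *.
    apply Rmult_le_compat_l; [exact H|].
    apply Rinv_le_contravar; [apply INR_fact_lt_0|]. apply le_INR, fact_le. lia.
  - apply functional_extensionality; intros i.
    apply functional_extensionality; intros j.
    unfold shiftLetter. ring.
Qed.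

Lemma densities_pos x : 0 < p x /\ 0 < q x.
Proof. split; eapply mixDens_pos; eassumption. Qed.

(** The majorant [G] serves twice: domination makes the cube integrals converge, and its explicit
    integral bounds their limit. *)
Lemma divNonneg_integral_exists D :
  exists v, isIntRd d (fun x => divNonneg D (p x) (q x)) v /\ 0 <= v <= e * m2.
Proof.
  pose proof katomic_w' as [Hw' [Hs' _]].
  set (G := fun x => sumn k (fun j =>
    w' j * (mixDens (k + k) d nu X x ^ 2 / gauss d x (mu' j)))).
  assert (HG : isIntRd d G (sumn k (fun j => w' j * expForm (k + k) d X nu (mu' j)))).
  { apply isIntRd_sumn. intros j _. apply isIntRd_scal, isIntRd_chi2_form. }
  assert (Hpos : forall x, 0 <= divNonneg D (p x) (q x)).
  { intros x. destruct (densities_pos x). eapply Rle_trans; [|apply divNonneg_ge_hellinger; auto].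
    apply pow2_ge_0. }
  assert (Hle : forall x, divNonneg D (p x) (q x) <= G x).
  { intros x. destruct (densities_pos x) as [Hp Hq].
    eapply Rle_trans; [apply divNonneg_le_chi2; auto|].
    unfold G, X, nu. rewrite mixDens_join. fold p q.
    apply Rle_trans with ((p x - q x) ^ 2 * sumn k (fun j => w' j / gauss d x (mu' j))).
    - apply Rmult_le_compat_l; [apply pow2_ge_0|].
      apply inv_mean_le; auto. intros; apply gauss_pos.
    - rewrite <- sumn_scal. apply sumn_le. intros j _. right. unfold Rdiv. ring. }
  edestruct (isIntRd_dominated d (fun x => divNonneg D (p x) (q x)) G) as [v Hv];
    [| |exact HG|].
  - apply cubeContinuous_divNonneg; try apply cubeContinuous_mixDens;
      try (eapply cubePositive_mixDens; eassumption); intros x; apply densities_pos.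
  - intros x. split; auto.
  - exists v. split; [exact Hv|]. split.
    + apply (isIntRd_le d (fun _ => 0) _ 0 v (isIntRd_0 d) Hv Hpos).
    + eapply Rle_trans; [apply (isIntRd_le _ _ _ _ _ Hv HG Hle)|].
      rewrite <- (Rmult_1_r (e * m2)), <- Hs', <- sumn_scal. apply sumn_le. intros j Hj.
      rewrite Rmult_comm. apply Rmult_le_compat_r; [auto|].
      apply expForm_le_maxMoment. now apply (katomic_sqnorm_le k d Rr w').
Qed.

(* Integrates the pointwise bound hellinger_ge_test with g = (p - q) / N(0, I). *)
Lemma divNonneg_integral_ge D v tau : isIntRd d (fun x => divNonneg D (p x) (q x)) v ->
  2 * tau * expForm (k + k) d X nu (fun _ => 0) - 4 * tau ^ 2 * (e * m2) <= v.
Proof.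
  intros Hv.
  set (g := fun x => mixDens (k + k) d nu X x / gauss d x (fun _ => 0)).
  set (T := fun (u : nat -> R) (y : nat -> nat -> R) => sumn k (fun i =>
    u i * (exp (- sqnorm d (y i)) * expForm (k + k) d X nu (fun j => - y i j)))).
  assert (HT : forall u y, isIntRd d (fun x => mixDens k d u y x * g x ^ 2) (T u y)).
  { intros u y. eapply isIntRd_ext; [|apply isIntRd_sumn; intros i _;
      apply isIntRd_scal, isIntRd_gauss_likelihood_sqr].
    intros x. cbv beta. rewrite Rmult_comm. unfold mixDens at 2. rewrite <- sumn_scal.
    apply sumn_ext. intros i _. unfold g. ring. }
  assert (HTle : forall u y, katomic k d Rr u y -> T u y <= e * m2).
  { intros u y Hu. pose proof Hu as [Hu0 [Hu1 _]].
    rewrite <- (Rmult_1_r (e * m2)), <- Hu1, <- sumn_scal. apply sumn_le. intros i Hi.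
    rewrite Rmult_comm. apply Rmult_le_compat_r; [auto|].
    (* The form is evaluated at the reflected atom, which is still in the ball. *)
    assert (Hn : sqnorm d (fun j => - y i j) <= Rr ^ 2).
    { replace (sqnorm d (fun j => - y i j)) with (sqnorm d (y i))
        by (apply sumn_ext; intros; ring).
      now apply (katomic_sqnorm_le k d Rr u). }
    pose proof (expForm_le_maxMoment _ Hn) as H1.
    assert (H2 : 0 <= expForm (k + k) d X nu (fun j => - y i j)).
    { eapply Rle_trans; [|apply (expForm_ge _ _ _ _ _ 0)].
      apply Rmult_le_pos; [apply wordNormSq_nonneg|].
      apply Rlt_le, Rinv_0_lt_compat, INR_fact_lt_0. }
    (* Since the form is nonnegative, the factor exp(-|y_i|^2) <= 1 can be replaced by 1. *)
    eapply Rle_trans; [|exact H1]. rewrite <- (Rmult_1_l (expForm _ _ _ _ _)) at 2.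
    apply Rmult_le_compat_r; [exact H2|]. rewrite <- exp_0. apply exp_monotone.
    pose proof (sqnorm_nonneg d (y i)). lra. }
  pose proof (isIntRd_plus _ _ _ _ _
    (isIntRd_scal d (2 * tau) _ _ (isIntRd_chi2_form (k + k) d nu X (fun _ => 0)))
    (isIntRd_scal d (- 2 * tau ^ 2) _ _ (isIntRd_plus _ _ _ _ _ (HT w mu) (HT w' mu')))) as HL.
  eapply Rle_trans; [|apply (isIntRd_le _ _ _ _ _ HL Hv)].
  - pose proof (HTle w mu katomic_w). pose proof (HTle w' mu' katomic_w').
    pose proof (pow2_ge_0 tau).
    assert (tau ^ 2 * (T w mu + T w' mu') <= tau ^ 2 * (2 * (e * m2)))
      by (apply Rmult_le_compat_l; lra).
    lra.
  - intros x. cbv beta. destruct (densities_pos x) as [Hp Hq].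
    eapply Rle_trans; [|apply divNonneg_ge_hellinger; auto].
    eapply Rle_trans; [|apply (hellinger_ge_test tau (g x)); auto].
    right. fold p q. unfold g, X, nu. rewrite mixDens_join. fold p q. unfold Rdiv. ring.
Qed.

Lemma divergence_bounds D :
  exists v, isIntRd d (fun x => divIntegrand D (p x) (q x)) v /\
    / (8 * e * INR k) ^ (4 * k) * m2 <= v <= e * m2.
Proof.
  destruct (divNonneg_integral_exists D) as [v [Hv [Hv0 Hv1]]].
  exists v. split.
  - destruct D; [exact Hv| |exact Hv].
    pose proof (isIntRd_mixDens k d w mu) as Ip. pose proof (isIntRd_mixDens k d w' mu') as Iq.
    (* Adding p - q, of integral 0, turns the nonnegative KL integrand back into p ln(p/q). *)
    pose proof (isIntRd_plus _ _ _ _ _ Hv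
      (isIntRd_plus _ _ _ _ _ Ip (isIntRd_scal _ (-1) _ _ Iq))) as H.
    pose proof katomic_w as [_ [Hs _]]. pose proof katomic_w' as [_ [Hs' _]].
    rewrite Hs, Hs' in H. replace (v + (1 + -1 * 1)) with v in H by ring.
    eapply isIntRd_ext; [|exact H]. intros x. simpl. fold p q. ring.
  - split; [|exact Hv1].
    assert (He : 1 <= e).
    { unfold e. rewrite <- exp_0. apply exp_monotone, pow2_ge_0. }
    pose proof (const_inequality e k He k_ge1) as HC.
    set (F := INR (fact (2 * k - 1))) in *.
    assert (HF : 0 < F) by apply INR_fact_lt_0.
    set (CK := (8 * e * INR k) ^ (4 * k)) in *.
    assert (HCK : 0 < 4 * e * F ^ 2) by (apply Rmult_lt_0_compat; [lra|apply pow_lt; lra]).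
    (* When all moment differences vanish the lower bound is 0; otherwise [m2] may be divided by. *)
    destruct (Rle_lt_or_eq_dec 0 m2 maxMoment_nonneg) as [Hm|Hm];
      [|rewrite <- Hm, Rmult_0_r; exact Hv0].
    pose proof expForm_ge_maxMoment as HK. fold F in HK.
    set (K := expForm (k + k) d X nu (fun _ => 0)) in *.
    assert (Hem : 0 < e * m2) by (apply Rmult_lt_0_compat; lra).
    (* This [tau] maximizes the quadratic 2 tau K - 4 tau^2 e m2, with maximum K^2 / (4 e m2). *)
    pose proof (divNonneg_integral_ge D v (K / (4 * (e * m2))) Hv) as H. fold K in H.
    replace (2 * (K / (4 * (e * m2))) * K - 4 * (K / (4 * (e * m2))) ^ 2 * (e * m2))
      with (K ^ 2 / (4 * (e * m2))) in H by (field; lra).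
    eapply Rle_trans; [|exact H].
    apply Rle_trans with ((m2 / F) ^ 2 / (4 * (e * m2))).
    + replace ((m2 / F) ^ 2 / (4 * (e * m2))) with (/ (4 * e * F ^ 2) * m2) by (field; lra).
      apply Rmult_le_compat_r; [lra|]. now apply Rinv_le_contravar.
    + apply Rmult_le_compat_r; [apply Rlt_le, Rinv_0_lt_compat; lra|].
      apply pow_incr. split; [|exact HK]. apply Rlt_le, Rdiv_lt_0_compat; lra.
Qed.

End MomentComparison.

Theorem mainTheorem7 :
  forall Rr : R, 0 < Rr ->
  exists C : R, 0 < C /\
  forall (k d : nat) (w w' : nat -> R) (mu mu' : nat -> nat -> R),
    (1 <= k)%nat ->
    katomic k d Rr w mu -> katomic k d Rr w' mu' ->
    forall D : Div,
    exists v : R,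
      IntRd d (fun x => divIntegrand D (mixDens k d w mu x) (mixDens k d w' mu' x)) v /\
      / (C * INR k) ^ (4 * k)
        * maxUpTo (2 * k - 1) (fun l => momDiffSq k d l w w' mu mu') <= v /\
      v <= C * exp (36 * INR k ^ 2)
        * maxUpTo (2 * k - 1) (fun l => momDiffSq k d l w w' mu mu').
Proof.
  intros Rr HR. set (e := exp ((1 + 3 * Rr) ^ 2)).
  assert (He : 0 < e) by apply exp_pos.
  (* The value comes from [const_inequality]; it depends on [Rr] alone and also exceeds the factor
     [e] of the upper bound. *)
  exists (8 * e). split; [lra|].
  intros k d w w' mu mu' Hk Hw Hw' D.
  destruct (divergence_bounds Rr k d w w' mu mu' HR Hk Hw Hw' D) as [v [Hv [Hl Hu]]].
  exists v. split; [now apply IntRd_isIntRd|]. split; [exact Hl|].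
  eapply Rle_trans; [exact Hu|].
  apply Rmult_le_compat_r; [now apply maxMoment_nonneg|].
  assert (1 <= exp (36 * INR k ^ 2)).
  { rewrite <- exp_0. apply exp_monotone. pose proof (pow2_ge_0 (INR k)). lra. }
  fold e. nra.
Qed.
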